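(* Assume $\Bbbk$ is uncountable. Every holonomic $A\mathcal{V}$-module has finite length.
   Context: Setup: $\Bbbk$ algebraically closed, characteristic $0$; $A=\Bbbk[x_1,\dots,x_n]$; $\mathcal{V}=\mathrm{Der}(A)$. An $A\mathcal{V}$-module is an $A$-module and $\mathcal{V}$-module $M$ with $\eta(fm)=\eta(f)m+f(\eta m)$, i.e. a module over the smash product $A\#U(\mathcal{V})$. $\mathrm{GKdim}_{A\mathcal{V}}$ is the Gelfand–Kirillov dimension over $A\#U(\mathcal{V})$: $\limsup_m\log_m\dim(C^mM_0)$ for a finite-dimensional generating subspace $C\ni1$ of the algebra and a finite-dimensional generating subspace $M_0$ of the module. A finitely generated $A\mathcal{V}$-module $M$ is holonomic if $M=0$ or $\mathrm{GKdim}_{A\mathcal{V}}(M)=n$. *)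

(* Defs.v *)
From HB Require Import structures.
From mathcomp Require Import all_boot all_order all_algebra.
From mathcomp Require Import mpoly.
From Stdlib Require Import Reals.
From Coquelicot Require Import Rbar Lub Lim_seq Rcomplements.

Set Implicit Arguments.
Unset Strict Implicit.
Unset Printing Implicit Defensive.

Import GRing.Theory.
Local Open Scope ring_scope.

Section AV.
Variables (k : fieldType) (n : nat).

Notation A := {mpoly k[n]}.

Definition is_der (d : A -> A) : Prop :=
  (forall (c : k) (f g : A), d (c *: f + g) = c *: d f + d g) /\
  (forall f g : A, d (f * g) = d f * g + f * d g).

Variable M : lmodType k.
Variable mulA : A -> M -> M.
Variable actV : (A -> A) -> M -> M.   (* the V-action; only its values on
                                         derivations are ever used *)

(* M is an A V-module (a module over the smash product A # U(V)). *)
Definition is_AVmodule : Prop :=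
  (forall f (c : k) (m1 m2 : M), mulA f (c *: m1 + m2) = c *: mulA f m1 + mulA f m2) /\
  (forall (f g : A) m, mulA (f + g) m = mulA f m + mulA g m) /\
  (forall (c : k) (f : A) m, mulA (c *: f) m = c *: mulA f m) /\
  (forall (f g : A) m, mulA (f * g) m = mulA f (mulA g m)) /\
  (forall m, mulA 1 m = m) /\
  (forall d, is_der d ->
     forall (c : k) (m1 m2 : M), actV d (c *: m1 + m2) = c *: actV d m1 + actV d m2) /\
  (forall d1 d2 d3 (c : k), is_der d1 -> is_der d2 -> is_der d3 ->
     (forall f, d3 f = c *: d1 f + d2 f) ->
     forall m, actV d3 m = c *: actV d1 m + actV d2 m) /\
  (forall d1 d2 d3, is_der d1 -> is_der d2 -> is_der d3 ->
     (forall f, d3 f = d1 (d2 f) - d2 (d1 f)) ->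
     forall m, actV d3 m = actV d1 (actV d2 m) - actV d2 (actV d1 m)) /\
  (forall d (f : A) m, is_der d -> actV d (mulA f m) = mulA (d f) m + mulA f (actV d m)).

Definition is_AVsub (S : M -> Prop) : Prop :=
  S 0 /\
  (forall (c : k) x y, S x -> S y -> S (c *: x + y)) /\
  (forall f x, S x -> S (mulA f x)) /\
  (forall d x, is_der d -> S x -> S (actV d x)).

Definition AV_fin_gen : Prop :=
  exists gens : seq M, forall S, is_AVsub S -> (forall g, g \in gens -> S g) ->
    forall m, S m.

Definition AV_finite_length : Prop :=
  exists (l : nat) (S : nat -> M -> Prop),
    (forall i, leq i l -> is_AVsub (S i)) /\
    (forall x, S 0%N x <-> x = 0) /\
    (forall x, S l x) /\
    (forall i, leq i.+1 l ->
       (forall x, S i x -> S i.+1 x) /\ (exists x, S i.+1 x /\ ~ S i x) /\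
       (forall T, is_AVsub T -> (forall x, S i x -> T x) -> (forall x, T x -> S i.+1 x) ->
          (forall x, T x -> S i x) \/ (forall x, S i.+1 x -> T x))).

Definition in_span (t : seq M) (x : M) : Prop :=
  exists c : nat -> k, x = \sum_(i < size t) c i *: t`_i.

Definition dim_span (s : seq M) : R :=
  real (Glb_Rbar (fun r => exists t : seq M,
          r = INR (size t) /\ forall x, x \in s -> in_span t x)).

(* Given a finite list of generators ops of the algebra (operators on M) and a
   finite list M0 of vectors, words_m lists vectors spanning C^m M0, where
   C = span (1 :: ops). *)
Fixpoint words (ops : seq (M -> M)) (M0 : seq M) (m : nat) : seq M :=
  match m with
  | O => M0
  | S m' => let L := words ops M0 m' in L ++ [seq op x | op <- ops, x <- L]
  end.

(* Gelfand-Kirillov dimension over A # U(V):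
   sup over finite-dimensional subspaces C of the algebra and M0 of M of
   limsup_m log_m dim (C^m M0).  Every finite-dimensional subspace of the
   image of A # U(V) in End_k(M) lies in some power of the span of 1 and
   finitely many generators mulA f, actV d. *)
Definition GKdim_AV : Rbar :=
  Rbar_lub (fun r => exists (fs : seq A) (ds : seq (A -> A)) (M0 : seq M),
    (forall d, List.In d ds -> is_der d) /\
    r = LimSup_seq (fun m =>
          ln (dim_span (words ([seq mulA f | f <- fs] ++ [seq actV d | d <- ds]) M0 m))
          / ln (INR m))%R).

Definition AV_holonomic : Prop :=
  AV_fin_gen /\ ((forall m : M, m = 0) \/ GKdim_AV = Finite (INR n)).

End AV.

(* Main.v *)
(* The operators 'X_i and actV d_i make M a module over the Weyl algebra D_n.
   If S is a D_n-submodule and v is not in S, Bernstein's inequality produces,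
   uniformly in S and v, at least q^n vectors that are independent modulo S and
   obtained from v by words of length at most 4 n q in the generators.
   Let C be spanned by 1, the variables and the derivations of degree at most
   3, and let M0 generate M. Since C D_n is contained in D_n C, the D_n-modules
   D_n C^i M0 form an ascending chain; were it strict, its q first layers would
   contribute q^{n+1} independent vectors to C^{O(q)} M0, so that the
   Gelfand-Kirillov dimension would be at least n+1. Hence it stops, its last
   term is stable under the vector fields (which are generated by those of
   degree at most 3), and M is finitely generated over D_n.
   Standard monomials then bound the growth of M over D_n: either they contain
   a coordinate face of dimension n+1, again contradicting the dimension, or
   all but boundedly many exponents of each of them are bounded, and the growth
   is at most K m^n. Against Bernstein's lower bound this limits the length of
   every strict chain of submodules. *)
From Stdlib Require Import Classical ClassicalEpsilon Reals Lra.
From Coquelicot Require Import Rbar Lub Lim_seq Rcomplements.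
Require Import Defs.
From HB Require Import structures.
From mathcomp Require Import all_boot all_order all_algebra.
From mathcomp Require Import mpoly.
From mathcomp Require Import zify ring.

Set Implicit Arguments.
Unset Strict Implicit.
Unset Printing Implicit Defensive.

Import Order.TTheory GRing.Theory.
Local Open Scope ring_scope.

(** * Linear algebra modulo a subspace *)

Lemma choice_fun (X Y : Type) (P : X -> Y -> Prop) :
  (forall x, exists y, P x y) -> exists f : X -> Y, forall x, P x (f x).
Proof.
move=> h; exists (fun x => proj1_sig (constructive_indefinite_description _ (h x))).
by move=> x; case: constructive_indefinite_description.
Qed.

(** A homogeneous system with more unknowns than equations: the rank is at most the number of
    columns, so the left kernel is nonzero. *)
Lemma lin_dep (k : fieldType) (I J : finType) (C : I -> J -> k) :
  (#|J| < #|I|)%N ->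
  exists u : I -> k, (exists i, u i != 0) /\ forall j, \sum_i u i * C i j = 0.
Proof.
move=> lt; pose A := \matrix_(i < #|I|, j < #|J|) C (enum_val i) (enum_val j).
have : kermx A != 0.
  rewrite -mxrank_eq0 mxrank_ker -lt0n subn_gt0.
  exact: leq_ltn_trans (rank_leq_col A) lt.
case/rowV0Pn=> v /sub_kermxP vA v0.
exists (fun i => v 0 (enum_rank i)); split.
  case/rV0Pn: v0 => i vi; exists (enum_val i); by rewrite enum_valK.
move=> j; have := congr1 (fun X : 'rV_ _ => X 0 (enum_rank j)) vA.
rewrite !mxE => h; rewrite -[RHS]h (reindex (@enum_val I I)) /=; last first.
  by apply: onW_bij; apply: enum_val_bij.
by apply: eq_bigr => i _; rewrite !mxE enum_valK enum_rankK.
Qed.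

Section RelativeLinearAlgebra.
Variables (k : fieldType) (M : lmodType k).
Implicit Types S P : M -> Prop.

Definition subspace S := S 0 /\ forall (c : k) x y, S x -> S y -> S (c *: x + y).

Lemma subspaceD S x y : subspace S -> S x -> S y -> S (x + y).
Proof. by move=> [_ h] sx sy; rewrite -[x]scale1r; apply: h. Qed.

Lemma subspaceZ S c x : subspace S -> S x -> S (c *: x).
Proof. by move=> [h0 h] sx; rewrite -[_ *: _]addr0; apply: h. Qed.

Lemma subspaceN S x : subspace S -> S x -> S (- x).
Proof. by move=> hS sx; rewrite -scaleN1r; apply: subspaceZ. Qed.

Lemma subspaceB S x y : subspace S -> S x -> S y -> S (x - y).
Proof. by move=> hS sx sy; apply: subspaceD => //; apply: subspaceN. Qed.

Lemma subspace_addr S x y : subspace S -> S y -> S (x + y) -> S x.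
Proof. by move=> hS sy sxy; rewrite -(addrK y x); apply: subspaceB. Qed.

Lemma subspace_sum S (I : Type) (r : seq I) (Q : pred I) (F : I -> M) :
  subspace S -> (forall i, Q i -> S (F i)) -> S (\sum_(i <- r | Q i) F i).
Proof. by move=> hS hF; apply: big_ind => //; [case: hS | move=> *; apply: subspaceD]. Qed.

Lemma subspace_zero : subspace (eq 0).
Proof. by split=> // c x y <- <-; rewrite scaler0 addr0. Qed.

(** Being an intersection of subspaces, it makes an induction over a span a mere choice of
    subspace. *)
Definition lspan P x := forall S, subspace S -> (forall y, P y -> S y) -> S x.

Lemma lspan_sub P : subspace (lspan P).
Proof.
split=> [S [h _] //|c x y hx hy S hS hP].
by case: (hS) => _; apply; [apply: hx | apply: hy].
Qed.

Lemma lspan_incl P x : P x -> lspan P x.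
Proof. by move=> px S _; apply. Qed.

Lemma lspanD P x y : lspan P x -> lspan P y -> lspan P (x + y).
Proof. by move=> hx hy S hS hP; apply: subspaceD => //; [apply: hx | apply: hy]. Qed.

Lemma lspanZ P c x : lspan P x -> lspan P (c *: x).
Proof. by move=> hx S hS hP; apply: subspaceZ => //; apply: hx. Qed.

Lemma lspan_addr P x y : lspan P y -> lspan P (x + y) -> lspan P x.
Proof. by move=> hy hxy S hS hP; apply: (subspace_addr (y := y)) => //; [apply: hy | apply: hxy]. Qed.

Lemma lspan_sum P (I : Type) (r : seq I) (Q : pred I) (F : I -> M) :
  (forall i, Q i -> lspan P (F i)) -> lspan P (\sum_(i <- r | Q i) F i).
Proof. by move=> hF S hS hP; apply: subspace_sum => // i /hF; apply. Qed.

(** Independence of the classes in M/S; the quotient is never formed. *)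
Definition indep S (I : finType) (F : I -> M) :=
  forall c : I -> k, S (\sum_i c i *: F i) -> forall i, c i = 0.

Definition spanned S (J : finType) (G : J -> M) x :=
  exists c : J -> k, S (x - \sum_j c j *: G j).

Lemma spanned_sub S (J : finType) (G : J -> M) : subspace S -> subspace (spanned S G).
Proof.
move=> hS; split.
  exists (fun _ => 0); rewrite big1 ?subr0; first by case: hS.
  by move=> j _; rewrite scale0r.
move=> c x y [u hu] [v hv]; exists (fun j => c * u j + v j).
have -> : c *: x + y - \sum_j (c * u j + v j) *: G j =
  c *: (x - \sum_j u j *: G j) + (y - \sum_j v j *: G j).
  rewrite scalerBr scaler_sumr addrACA -opprD -big_split /=.
  by congr (_ - _); apply: eq_bigr => j _; rewrite scalerDl scalerA.
by case: hS => _; apply.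
Qed.

Lemma spanned_incl S (J : finType) (G : J -> M) j : subspace S -> spanned S G (G j).
Proof.
move=> hS; exists (fun i => (i == j)%:R).
rewrite (bigD1 j) //= eqxx scale1r big1 ?addr0 ?subrr; first by case: hS.
by move=> i /negPf ->; rewrite scale0r.
Qed.

Lemma lspan_spanned P (J : finType) (G : J -> M) x :
  (forall y, P y -> exists j, y = G j) -> lspan P x -> spanned (eq 0) G x.
Proof.
move=> hP; apply; first exact/spanned_sub/subspace_zero.
by move=> y /hP [j ->]; apply/spanned_incl/subspace_zero.
Qed.

(** If I were larger than J, some nontrivial combination of the rows of coefficients would vanish;
    the same combination of the F i would lie in S. *)
Lemma indep_leq_card S (I J : finType) (F : I -> M) (G : J -> M) :
  subspace S -> indep S F -> (forall i, spanned S G (F i)) -> (#|I| <= #|J|)%N.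
Proof.
move=> hS hF /choice_fun [C hC]; rewrite leqNgt; apply/negP => /(lin_dep C).
case=> u [[i ui] uC]; move: ui; rewrite (hF u) ?eqxx //.
have -> : \sum_i u i *: F i = \sum_i u i *: (F i - \sum_j C i j *: G j).
  have e : \sum_i u i *: (\sum_j C i j *: G j) = 0.
    rewrite (eq_bigr _ (fun i _ => scaler_sumr _ _ _ _)) exchange_big big1 //= => j _.
    rewrite (eq_bigr _ (fun i _ => scalerA _ _ _)) -scaler_suml uC scale0r //.
  by rewrite (eq_bigr _ (fun i _ => scalerBr _ _ _)) sumrB e subr0.
by apply: subspace_sum => // i' _; apply: subspaceZ.
Qed.

Lemma indep_inj S (I I' : finType) (F : I -> M) (f : I' -> I) :
  injective f -> indep S F -> indep S (fun i => F (f i)).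
Proof.
move=> fi hF c hc j.
(* The coefficients are pushed forward along [f]; each fibre has at most one element. *)
have hc' := hF (fun i => \sum_(j | f j == i) c j).
rewrite -[RHS](hc' _ (f j)).
  by rewrite (big_pred1 j) // => i; rewrite /= (inj_eq fi).
suff -> : \sum_i (\sum_(j | f j == i) c j) *: F i = \sum_j c j *: F (f j) by [].
rewrite [RHS](partition_big f predT) //=; apply: eq_bigr => i _.
by rewrite scaler_suml; apply: eq_bigr => i' /eqP ->.
Qed.

Lemma indep_basis S (t : seq M) : subspace S -> exists s : seq M,
  [/\ indep S (fun i : 'I_(size s) => s`_i), {subset s <= t} &
      forall x, x \in t -> spanned S (fun i : 'I_(size s) => s`_i) x].
Proof.
move=> hS; elim: t => [|x t [s [hi hs ht]]].
  by exists [::]; split=> // c _ [].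
have [hx|hx] := classic (spanned S (fun i : 'I_(size s) => s`_i) x).
  exists s; split=> // y; first by move/hs; rewrite inE orbC => ->.
  by rewrite inE => /orP [/eqP -> //|/ht].
exists (x :: s); split.
- move=> c; rewrite big_ord_recl /= => hc.
  have c0 : c ord0 = 0.
    apply: NNPP => /eqP nz; apply: hx.
    exists (fun i => - (c ord0)^-1 * c (lift ord0 i)).
    have -> : x - \sum_(j < size s) (- (c ord0)^-1 * c (lift ord0 j)) *: s`_j =
       (c ord0)^-1 *: (c ord0 *: x + \sum_(i < size s) c (lift ord0 i) *: s`_i).
      rewrite scalerDr scalerA mulVf // scale1r; congr (_ + _).
      rewrite scaler_sumr -sumrN; apply: eq_bigr => j _.
      by rewrite mulNr scaleNr opprK scalerA.
    exact: subspaceZ.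
  move=> i; have [j ->|->] := unliftP ord0 i; last exact: c0.
  by move: hc; rewrite c0 scale0r add0r => /hi ->.
- by move=> y; rewrite !inE => /orP [->//|/hs ->]; rewrite orbT.
move=> y; rewrite inE => /orP [/eqP ->|/ht [c hc]].
  exact: (spanned_incl (fun i : 'I_(size s).+1 => (x :: s)`_i) ord0).
exists (fun i => if unlift ord0 i is Some j then c j else 0).
rewrite big_ord_recl unlift_none scale0r add0r.
by under eq_bigr => i _ do rewrite liftK /=.
Qed.

(** A relation is peeled from the top: all layers below m lie in S m, so independence modulo S m
    kills the coefficients of layer m. *)
Lemma indep_layers (S : nat -> M -> Prop) (J : finType) (F : nat -> J -> M) l :
  (forall i, (i <= l)%N -> subspace (S i)) ->
  (forall i x, (i < l)%N -> S i x -> S i.+1 x) ->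
  (forall i, (i < l)%N -> indep (S i) (F i)) ->
  (forall i j, (i < l)%N -> S i.+1 (F i j)) ->
  indep (S 0%N) (fun p : 'I_l * J => F p.1 p.2).
Proof.
move=> hS mono hF hFS.
(* Coefficients indexed by all naturals let the number of layers decrease in the induction. *)
suff h m (c : nat -> J -> k) : (m <= l)%N -> S 0%N (\sum_(i < m) \sum_j c i j *: F i j) ->
    forall i j, (i < m)%N -> c i j = 0.
  move=> c hc [i j].
  pose c' a b := if insub a is Some a' then c (a', b) else 0.
  have := h l c' (leqnn l); rewrite /c'.
  rewrite pair_bigA /= => /(_ _ i j (ltn_ord i)); rewrite valK; apply.
  congr (S 0%N _): hc; apply: eq_bigr => -[a b] _ /=; by rewrite valK.
have up a : (a <= l)%N -> forall x, S 0%N x -> S a x.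
  by elim: a => // a IH la x /IH h; apply: mono => //; apply: h; apply: ltnW.
have up2 b a : (a <= b)%N -> (b <= l)%N -> forall x, S a x -> S b x.
  elim: b => [|b IH]; first by rewrite leqn0 => /eqP ->.
  rewrite leq_eqVlt => /orP [/eqP -> //|ab bl x sx].
  by apply: mono => //; apply: IH => //; apply: ltnW.
elim: m => // m IH ml hc.
have cm : forall j, c m j = 0.
  apply: (hF m) => //; have := up _ (ltnW ml) _ hc.
  rewrite big_ord_recr /= addrC; apply: subspace_addr; first exact: hS (ltnW ml).
  apply: subspace_sum => [|i _]; first exact: hS (ltnW ml).
  apply: subspace_sum => [|j _]; first exact: hS (ltnW ml).
  apply: subspaceZ; first exact: hS (ltnW ml).
  apply: (up2 _ i.+1) => //; first exact: ltnW.
  by apply: hFS; apply: ltn_trans ml.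
move=> i j; rewrite ltnS leq_eqVlt => /orP [/eqP -> //|im].
apply: IH => //; first exact: ltnW.
congr (S 0%N _): hc; rewrite big_ord_recr /= [X in _ + X]big1 ?addr0 // => j' _.
by rewrite cm scale0r.
Qed.

End RelativeLinearAlgebra.

(** * Growth and Gelfand-Kirillov dimension *)

Delimit Scope R_scope with Re.

Lemma INR_expn q n : INR (q ^ n) = (INR q ^ n)%Re.
Proof. by elim: n => [|n IH] //; rewrite expnS mult_INR IH. Qed.

(** Along m = c q the quotient is at least (n+1) ln q / (ln c + ln q), which tends to n+1. *)
Lemma limsup_log_growth (d : nat -> R) (n c : nat) :
  (0 < c)%N -> (forall q, (0 < q)%N -> (INR (q ^ n.+1) <= d (c * q)%N)%Re) ->
  Rbar_le (LimSup_seq (fun m => (ln (d m) / ln (INR m))%Re)) (Rbar.Finite (INR n)) -> False.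
Proof.
move=> c0 hd; set u := fun m => _ => hle.
have [N hN] : exists N, forall m, (N <= m)%coq_nat -> (u m < INR n + / 2)%Re.
  move: hle; rewrite /LimSup_seq; case: ex_LimSup_seq => -[l| |] /= hl hle //.
    have [_ [N hN]] := hl (mkposreal (/2)%Re ltac:(lra)).
    by exists N => m /hN /=; lra.
(* The inequality (n+1) ln q > (n+1/2) (ln c + ln q) amounts to q > c^(2n+1). The term N ensures c q
   >= N, and 2 ensures ln q > 0. *)
pose q := (c ^ (n.*2.+1) + N + 2)%N.
have q0 : (0 < q)%N by rewrite /q addn2.
have qN : (N <= (c * q)%N)%coq_nat.
  apply/ssrnat.leP; apply: leq_trans (leq_pmull q c0); rewrite /q; lia.
have := hN _ qN; rewrite /u; have := hd q q0.
rewrite INR_expn => h1 h2.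
have c1 : (1 <= INR c)%Re by apply: (le_INR 1); apply/ssrnat.leP.
have qq : (INR c ^ (n.*2.+1) + 2 <= INR q)%Re.
  rewrite -INR_expn -(plus_INR _ 2); apply: le_INR; apply/ssrnat.leP; rewrite /q plusE; lia.
have cp : (0 < INR c ^ (n.*2.+1))%Re by apply: pow_lt; lra.
have qp : (1 < INR q)%Re by lra.
have lq : (0 < ln (INR q))%Re by rewrite -ln_1; apply: ln_increasing; lra.
have lc : (0 <= ln (INR c))%Re by rewrite -ln_1; apply: ln_le; lra.
have lm : (ln (INR (c * q)) = ln (INR c) + ln (INR q))%Re.
  by rewrite mult_INR ln_mult; lra.
have l1 : (INR n.+1 * ln (INR q) <= ln (d (c * q)%N))%Re.
  rewrite -ln_pow; last by lra.
  by apply: ln_le => //; apply: pow_lt; lra.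
have l2 : (ln (d (c * q)%N) < (INR n + / 2) * (ln (INR c) + ln (INR q)))%Re.
  move: h2; rewrite lm => h2.
  have := Rmult_lt_compat_r _ _ _ (Rplus_le_lt_0_compat _ _ lc lq) h2.
  by rewrite /Rdiv Rmult_assoc Rinv_l ?Rmult_1_r //; lra.
have l3 : (INR (n.*2.+1) * ln (INR c) < ln (INR q))%Re.
  rewrite -ln_pow; last by lra.
  by apply: ln_increasing => //; lra.
move: l3 l1; rewrite !S_INR -addnn plus_INR => l3 l1; nra.
Qed.

Section Span.
Variables (k : fieldType) (M : lmodType k).

Lemma in_span_lspan (t : seq M) x : in_span t x <-> lspan (fun y => y \in t) x.
Proof.
split=> [[c ->] S hS ht|].
  apply: subspace_sum => // i _; apply: subspaceZ => //; apply: ht.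
  exact: mem_nth.
have := @lspan_spanned _ _ (fun y => y \in t) _ (fun i : 'I_(size t) => t`_i) x.
move=> h /h [] => [y /(nthP 0) [i it <-]|c hc].
  by exists (Ordinal it).
exists (fun i => if insub i is Some j then c j else 0).
move/esym/eqP: hc; rewrite subr_eq0 => /eqP ->.
by apply: eq_bigr => i _; rewrite valK.
Qed.

Lemma lspan_trans (P Q : M -> Prop) x :
  (forall y, P y -> lspan Q y) -> lspan P x -> lspan Q x.
Proof. by move=> h; apply => //; apply: lspan_sub. Qed.

Lemma lspan_seq_leq_card (t : seq M) (I : finType) (F : I -> M) S :
  subspace S -> indep S F -> (forall i, lspan (fun y => y \in t) (F i)) ->
  (#|I| <= size t)%N.
Proof.
move=> hS hF ht; rewrite -[X in (_ <= X)%N]card_ord.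
apply: (@indep_leq_card _ _ S _ _ F (fun i : 'I_(size t) => t`_i)) => // i.
apply: (ht i); first exact: spanned_sub.
move=> y /(nthP 0) [j jt <-].
exact: (spanned_incl (fun i : 'I_(size t) => t`_i) (Ordinal jt)).
Qed.

Lemma dim_span_ge (t : seq M) (I : finType) (F : I -> M) :
  indep (eq 0) F -> (forall i, lspan (fun y => y \in t) (F i)) ->
  (INR #|I| <= Defs.dim_span t)%Re.
Proof.
move=> hF ht; rewrite /Defs.dim_span; set E := fun r => _.
have [lb glb] := Glb_Rbar_correct E.
have Et : E (INR (size t)).
  by exists t; split=> // x xt; apply/in_span_lspan; apply: lspan_incl.
have {}lb := lb _ Et.
have : Rbar_le (Rbar.Finite (INR #|I|)) (Glb_Rbar E).
  apply: glb => r [t' [-> ht']] /=; apply: le_INR; apply/ssrnat.leP.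
  apply: (lspan_seq_leq_card (@subspace_zero _ _) hF) => i.
  by apply: lspan_trans (ht i) => y /ht' /in_span_lspan.
(* The two bounds exclude infinite values, which [real] would send to 0. *)
by case: (Glb_Rbar E) lb.
Qed.

Lemma mem_wordsS (ops : seq (M -> M)) M0 m x :
  x \in words ops M0 m -> x \in words ops M0 m.+1.
Proof. by move=> h; rewrite /= mem_cat h. Qed.

Lemma mem_words_leq (ops : seq (M -> M)) M0 m p x : (m <= p)%N ->
  x \in words ops M0 m -> x \in words ops M0 p.
Proof.
elim: p => [|p IH]; first by rewrite leqn0 => /eqP ->.
rewrite leq_eqVlt => /orP [/eqP -> //|/IH h xm]; apply: mem_wordsS; exact: h.
Qed.

Lemma mem_words_op (ops : seq (M -> M)) M0 m op x :
  List.In op ops -> x \in words ops M0 m -> op x \in words ops M0 m.+1.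
Proof.
move=> hop hx; rewrite /= mem_cat; apply/orP; right.
elim: ops {hx} (words ops M0 m) hx hop => [//|o ops IH] L hL /= [->|/IH h].
  by rewrite mem_cat map_f.
by rewrite mem_cat h ?orbT.
Qed.

Lemma mem_wordsS_inv (ops : seq (M -> M)) M0 m x :
  x \in words ops M0 m.+1 -> x \in words ops M0 m \/
  exists op y, [/\ List.In op ops, y \in words ops M0 m & x = op y].
Proof.
rewrite /= mem_cat => /orP [|]; first by left.
elim: ops (words ops M0 m) => [//|o ops IH] L /=.
rewrite mem_cat => /orP [/mapP [y yL ->]|/IH [h|[op [y [h1 h2 h3]]]]].
- by right; exists o, y; split=> //; left.
- by left.
by right; exists op, y; split=> //; right.
Qed.

End Span.

Section GK.
Variables (k : fieldType) (n : nat) (M : lmodType k).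
Variables (mulA : {mpoly k[n]} -> M -> M).
Variables (actV : ({mpoly k[n]} -> {mpoly k[n]}) -> M -> M).

(** The only form in which the dimension hypothesis enters: a single choice of operators and vectors
    with growth of order n+1 already pushes the supremum above n. *)
Lemma GKdim_no_growth fs ds M0 c :
  GKdim_AV mulA actV = Rbar.Finite (INR n) ->
  (forall d, List.In d ds -> is_der d) -> (0 < c)%N ->
  ~ forall q, (0 < q)%N -> exists (I : finType) (F : I -> M),
    [/\ #|I| = (q ^ n.+1)%N, indep (eq 0) F &
     forall i, lspan (fun y =>
      y \in words ([seq mulA f | f <- fs] ++ [seq actV d | d <- ds]) M0 (c * q)) (F i)].
Proof.
move=> hGK hds c0 hq.
pose d m := Defs.dim_span (words ([seq mulA f | f <- fs] ++ [seq actV d | d <- ds]) M0 m).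
apply: (@limsup_log_growth d n c c0).
  by move=> q /hq [I [F [cI hF hI]]]; rewrite -cI; apply: dim_span_ge hF hI.
rewrite -hGK /GKdim_AV; set E := fun r => _.
by rewrite /Rbar_lub; case: Rbar_ex_lub => l [ub lub] /=; apply: ub; exists fs, ds, M0.
Qed.

End GK.

(** * Weyl algebra modules and the Bernstein inequality *)

Lemma mnm_neq0 N (m : 'X_{1..N}) : m != 0%MM -> exists i, m i != 0%N.
Proof.
move=> nz; apply/existsP; rewrite -negb_forall; apply: contra nz => /forallP h.
by apply/eqP/mnmP => i; rewrite mnm0E; apply/eqP.
Qed.

Lemma mnm_ind N (P : 'X_{1..N} -> Prop) :
  P 0%MM -> (forall m i, P m -> P (m + U_(i))%MM) -> forall m, P m.
Proof.
move=> h0 hS m; have [d] := ubnP (mdeg m); elim: d m => // d IH m hm.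
have [->//|/mnm_neq0 [i mi]] := eqVneq m 0%MM.
have e : m = (m - U_(i) + U_(i))%MM by rewrite submK // lep1mP.
rewrite e; apply: hS; apply: IH; move: hm; rewrite {1}e mdegD mdeg1 addn1; lia.
Qed.

(** * Linear extension from monomials to polynomials *)

Section MonomialExtension.
Variables (k : fieldType) (N : nat) (M : lmodType k).
Implicit Types (F : 'X_{1..N} -> M) (p q : {mpoly k[N]}).

Definition ext F p := \sum_(m <- msupp p) p@_m *: F m.

Lemma ext_supset F p (s : seq 'X_{1..N}) : uniq s -> {subset msupp p <= s} ->
  ext F p = \sum_(m <- s) p@_m *: F m.
Proof.
move=> us sub; rewrite [RHS](bigID (mem (msupp p))) /= [X in _ + X]big1 ?addr0.
  rewrite -big_filter; apply: perm_big; apply: uniq_perm => //.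
  - by rewrite filter_uniq.
  - by move=> m; rewrite mem_filter /= andbC; case: (boolP (m \in msupp p)) => [/sub ->|]; rewrite ?andbF.
by move=> m /memN_msupp_eq0 ->; rewrite scale0r.
Qed.

Lemma ext_linear F (c : k) p q : ext F (c *: p + q) = c *: ext F p + ext F q.
Proof.
(* A common support puts the three sums over the same list. *)
pose s := undup (msupp p ++ msupp q ++ msupp (c *: p + q)).
have sE r : {subset msupp r <= msupp p ++ msupp q ++ msupp (c *: p + q)} ->
    ext F r = \sum_(m <- s) r@_m *: F m.
  move=> h; apply: ext_supset; first exact: undup_uniq.
  by move=> m /h; rewrite mem_undup.
rewrite !sE; try by move=> m h; rewrite !mem_cat h ?orbT.
rewrite scaler_sumr -big_split /=; apply: eq_bigr => m _.
by rewrite mcoeffD mcoeffZ scalerDl scalerA.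
Qed.

Lemma ext0 F : ext F 0 = 0.
Proof. by rewrite /ext msupp0 big_nil. Qed.

Lemma extX F m : ext F 'X_[m] = F m.
Proof. by rewrite /ext msuppX big_seq1 mcoeffX eqxx scale1r. Qed.

Lemma extZX F (c : k) m : ext F (c *: 'X_[m]) = c *: F m.
Proof. by rewrite -[_ *: _ in LHS]addr0 ext_linear ext0 addr0 extX. Qed.

Lemma ext_sumX F (I : finType) (c : I -> k) (m : I -> 'X_{1..N}) :
  ext F (\sum_i c i *: 'X_[m i]) = \sum_i c i *: F (m i).
Proof.
elim: (index_enum I) => [|i r IH]; first by rewrite !big_nil ext0.
by rewrite !big_cons ext_linear extX IH.
Qed.

Lemma mpoly_ext_eq (A B : {mpoly k[N]} -> M) :
  (forall c p q, A (c *: p + q) = c *: A p + A q) ->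
  (forall c p q, B (c *: p + q) = c *: B p + B q) ->
  (forall m, A 'X_[m] = B 'X_[m]) -> forall p, A p = B p.
Proof.
move=> hA hB hX; apply: mpolyind.
  have z (C : {mpoly k[N]} -> M) : (forall c p q, C (c *: p + q) = c *: C p + C q) -> C 0 = 0.
    by move=> hC; have := hC (-1) 0 0; rewrite scaler0 addr0 scaleN1r addNr.
  by rewrite !z.
by move=> c m p _ _ e; rewrite hA hB hX e.
Qed.

End MonomialExtension.

(** The coefficient of a nonconstant monomial reappears in some partial derivative, multiplied by a
    positive exponent, which is invertible in characteristic 0. *)
Lemma mderiv_eq0 (k : fieldType) N (p : {mpoly k[N]}) :
  [pchar k] =i pred0 -> (forall i, p^`M(i) = 0) -> p = (p@_0)%:MP.
Proof.
move=> /pcharf0P hk hp; apply/mpolyP => m; rewrite mcoeffC.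
have [->|nz] := eqVneq m 0%MM; first by rewrite mulr1.
have [i mi] := mnm_neq0 nz; rewrite mulr0.
have := mcoeff_mderiv i p (m - U_(i))%MM; rewrite hp mcoeff0 submK ?lep1mP //.
rewrite -mulr_natr => /esym/eqP; rewrite mulf_eq0 hk orbF => /eqP -> //.
Qed.

(** A module over the Weyl algebra D_n, with [D i] the action of the i-th partial derivative. *)
Record weyl_module (k : fieldType) n (M : lmodType k)
  (mulA : {mpoly k[n]} -> M -> M) (D : 'I_n -> M -> M) : Prop := WeylModule {
  wmul_lin : forall f (c : k) (u v : M), mulA f (c *: u + v) = c *: mulA f u + mulA f v;
  wmul_add : forall (f g : {mpoly k[n]}) v, mulA (f + g) v = mulA f v + mulA g v;
  wmul_scale : forall (c : k) f v, mulA (c *: f) v = c *: mulA f v;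
  wmul_mul : forall (f g : {mpoly k[n]}) v, mulA (f * g) v = mulA f (mulA g v);
  wmul_1 : forall v, mulA 1 v = v;
  wD_lin : forall i (c : k) (u v : M), D i (c *: u + v) = c *: D i u + D i v;
  wD_comm : forall i j v, D i (D j v) = D j (D i v);
  wD_leibniz : forall i f v, D i (mulA f v) = mulA f^`M(i) v + mulA f (D i v) }.

Section Linear.
Variables (k : fieldType) (M : lmodType k) (f : M -> M).
Hypothesis f_lin : forall (c : k) u v, f (c *: u + v) = c *: f u + f v.

Lemma lin0 : f 0 = 0.
Proof. by have := f_lin (-1) 0 0; rewrite scaler0 addr0 scaleN1r addNr. Qed.

Lemma linD u v : f (u + v) = f u + f v.
Proof. by have := f_lin 1 u v; rewrite !scale1r. Qed.

Lemma linZ (c : k) u : f (c *: u) = c *: f u.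
Proof. by have := f_lin c u 0; rewrite lin0 !addr0. Qed.

Lemma lin_sum (I : Type) (r : seq I) (P : pred I) (F : I -> M) :
  f (\sum_(i <- r | P i) F i) = \sum_(i <- r | P i) f (F i).
Proof. exact: (big_morph f linD lin0). Qed.

Lemma lin_preim (S : M -> Prop) : subspace S -> subspace (fun x => S (f x)).
Proof.
move=> [h0 h]; split; first by rewrite lin0.
by move=> c x y hx hy; rewrite f_lin; apply: h.
Qed.

Lemma lin_lspan (P Q : M -> Prop) x :
  (forall y, P y -> lspan Q (f y)) -> lspan P x -> lspan Q (f x).
Proof. move=> h hx; apply: (hx (fun y => lspan Q (f y))) => //.
by apply: lin_preim; apply: lspan_sub. Qed.

End Linear.

Section Weyl.
Variables (k : fieldType) (n : nat) (M : lmodType k).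
Variables (mulA : {mpoly k[n]} -> M -> M) (D : 'I_n -> M -> M).
Hypothesis W : weyl_module mulA D.

Let D_lin i := wD_lin W i.
Let mul_lin f := wmul_lin W f.

Definition dpow (b : 'X_{1..n}) v := foldr (fun i w => iter (b i) (D i) w) v (enum 'I_n).

Lemma D_iter i j m v : D j (iter m (D i) v) = iter m (D i) (D j v).
Proof. by elim: m => //= m <-; rewrite (wD_comm W). Qed.

Lemma dpow_D b j v : dpow b (D j v) = D j (dpow b v).
Proof.
rewrite /dpow; elim: (enum _) => //= i s ->.
by rewrite D_iter.
Qed.

Lemma dpowS b j v : dpow (b + U_(j))%MM v = D j (dpow b v).
Proof.
rewrite /dpow; have : uniq (enum 'I_n) by apply: enum_uniq.
have : j \in enum 'I_n by rewrite mem_enum.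
elim: (enum _) => //= i s IH; rewrite inE => /orP [/eqP <-|js] /andP [ni us].
  rewrite mnmDE mnm1E eqxx addn1 /=; congr (D _ (iter _ _ _)).
  elim: s ni {us IH} => //= l s IH; rewrite inE negb_or => /andP [jl /IH ->].
  by rewrite mnmDE mnm1E (negbTE jl) addn0.
rewrite IH // D_iter mnmDE mnm1E (_ : (j == i) = false) ?addn0 //.
by apply/eqP => e; rewrite -e js in ni.
Qed.

Lemma dpow0 v : dpow 0%MM v = v.
Proof. by rewrite /dpow; elim: (enum _) => //= i s ->; rewrite mnm0E. Qed.

Lemma dpow_lin b (c : k) u v : dpow b (c *: u + v) = c *: dpow b u + dpow b v.
Proof.
elim/mnm_ind: b => [|b i IH]; first by rewrite !dpow0.
by rewrite !dpowS IH D_lin.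
Qed.

(** The commutation rule [d^b, x_j] = b_j d^(b - e_j). *)
Lemma dpowX b j v : dpow b (mulA 'X_j v) =
  mulA 'X_j (dpow b v) + (b j)%:R *: dpow (b - U_(j))%MM v.
Proof.
elim/mnm_ind: b => [|b i IH]; first by rewrite !dpow0 mnm0E scale0r addr0.
rewrite !dpowS IH (linD (D_lin i)) (linZ (D_lin i)) (wD_leibniz W) mderivX.
rewrite mnm1E mnmDE mnm1E (wmul_scale W) (eq_sym j i).
rewrite [X in X + _ = _]addrC -addrA; congr (_ + _).
have e : (b j)%:R *: D i (dpow (b - U_(j))%MM v) =
         (b j)%:R *: dpow (b + U_(i) - U_(j))%MM v.
  (* If b_j = 0 the truncated difference of exponents is wrong, but its coefficient vanishes. *)
  have [->|bj] := eqVneq (b j) 0%N; first by rewrite !scale0r.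
  congr (_ *: _); rewrite -dpowS; congr (dpow _ v); apply/mnmP => l.
  rewrite !(mnmBE, mnmDE, mnm1E); have [<-|] := eqVneq j l; lia.
rewrite e natrD scalerDl addrC; congr (_ + _).
have [<-|ij] := eqVneq i j; last by rewrite !scale0r.
by rewrite -[X in 'X_[X - _]]add0m !addmK mpolyX0 (wmul_1 W).
Qed.

Definition lmn (m : 'X_{1..n + n}) := [multinom m (lshift n i) | i < n].
Definition rmn (m : 'X_{1..n + n}) := [multinom m (rshift n i) | i < n].
(** The normally ordered monomial x^alpha d^beta, with (alpha, beta) packed into one exponent vector
    of length 2n, so that symbols are polynomials in 2n variables. *)
Definition phi m v := mulA 'X_[lmn m] (dpow (rmn m) v).
Definition gen (i : 'I_(n + n)) : M -> M :=
  match split i with inl j => mulA 'X_j | inr j => D j end.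

Lemma split_ind (P : 'I_(n + n) -> Prop) :
  (forall j, P (lshift n j)) -> (forall j, P (rshift n j)) -> forall i, P i.
Proof. by move=> hl hr i; case: (split_ordP i) => j ->. Qed.

Lemma gen_l j : gen (lshift n j) = mulA 'X_j.
Proof. by rewrite /gen (unsplitK (inl j)). Qed.

Lemma gen_r j : gen (rshift n j) = D j.
Proof. by rewrite /gen (unsplitK (inr j)). Qed.

Lemma gen_lin i (c : k) u v : gen i (c *: u + v) = c *: gen i u + gen i v.
Proof. by rewrite /gen; case: split => j; [apply: mul_lin | apply: D_lin]. Qed.

Lemma phi_lin m (c : k) u v : phi m (c *: u + v) = c *: phi m u + phi m v.
Proof. by rewrite /phi dpow_lin mul_lin. Qed.

Lemma phi0 v : phi 0%MM v = v.
Proof.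
have l0 : lmn 0%MM = 0%MM by apply/mnmP => i; rewrite mnmE !mnm0E.
have r0 : rmn 0%MM = 0%MM by apply/mnmP => i; rewrite mnmE !mnm0E.
by rewrite /phi l0 r0 mpolyX0 (wmul_1 W) dpow0.
Qed.

Lemma gen_phi_l j m v : gen (lshift n j) (phi m v) = phi (m + U_(lshift n j))%MM v.
Proof.
rewrite gen_l /phi -(wmul_mul W) -mpolyXD; congr (mulA 'X_[_] (dpow _ _)).
  by apply/mnmP => i; rewrite !(mnmE, mnmDE, mnm1E) addnC (inj_eq (@lshift_inj _ _)).
by apply/mnmP => i; rewrite !(mnmE, mnmDE, mnm1E) eq_lrshift addn0.
Qed.

Lemma gen_phi_r j m v : gen (rshift n j) (phi m v) =
  phi (m + U_(rshift n j))%MM v + (m (lshift n j))%:R *: phi (m - U_(lshift n j))%MM v.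
Proof.
rewrite gen_r /phi (wD_leibniz W) mderivX mnmE (wmul_scale W) addrC -dpowS.
congr (mulA 'X_[_] (dpow _ _) + _ *: mulA 'X_[_] (dpow _ _)); apply/mnmP => i;
 rewrite !(mnmE, mnmDE, mnmBE, mnm1E) ?(inj_eq (@lshift_inj _ _)) ?(inj_eq (@rshift_inj _ _)) //.
  by rewrite eq_rlshift addn0.
by rewrite eq_lrshift subn0.
Qed.

Lemma phi_gen_r j m v : phi m (gen (rshift n j) v) = phi (m + U_(rshift n j))%MM v.
Proof.
rewrite gen_r /phi dpow_D -dpowS; congr (mulA 'X_[_] (dpow _ _)); apply/mnmP => i;
 rewrite !(mnmE, mnmDE, mnmBE, mnm1E) ?(inj_eq (@lshift_inj _ _)) ?(inj_eq (@rshift_inj _ _)) //.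
by rewrite eq_rlshift addn0.
Qed.

Lemma phi_gen_l j m v : phi m (gen (lshift n j) v) =
  phi (m + U_(lshift n j))%MM v + (m (rshift n j))%:R *: phi (m - U_(rshift n j))%MM v.
Proof.
rewrite -gen_phi_l !gen_l /phi dpowX (linD (mul_lin _)) (linZ (mul_lin _)) mnmE.
rewrite -!(wmul_mul W) -!mpolyXD (addmC (lmn m)).
congr (_ + _ *: mulA 'X_[_] (dpow _ _)); apply/mnmP => i;
 rewrite !(mnmE, mnmDE, mnmBE, mnm1E) ?(inj_eq (@lshift_inj _ _)) ?(inj_eq (@rshift_inj _ _)) //.
by rewrite eq_rlshift subn0.
Qed.

(** A generator multiplies the symbol by its variable, up to one correction term of smaller degree
    than the leading one. *)
Lemma gen_phi i m v : exists (c : k) m', (mdeg m' <= mdeg m)%N /\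
  gen i (phi m v) = phi (m + U_(i))%MM v + c *: phi m' v.
Proof.
elim/split_ind: i => j.
  by exists 0, m; rewrite scale0r addr0 gen_phi_l.
exists (m (lshift n j))%:R, (m - U_(lshift n j))%MM; split; first exact: mdegB.
exact: gen_phi_r.
Qed.

(* [gen (swap i)] and [gen i] generate one Heisenberg pair, so that the
   commutator with [gen (swap i)] acts on symbols as the derivative in the
   [i]-th variable, up to sign. *)
Definition swap (i : 'I_(n + n)) : 'I_(n + n) :=
  match split i with inl j => rshift n j | inr j => lshift n j end.

Lemma comm_phi i (m : 'X_{1..n + n}) v :
  (m i)%:R *: phi (m - U_(i))%MM v =
  (if split i then 1 else -1) *: (gen (swap i) (phi m v) - phi m (gen (swap i) v)).
Proof.
elim/split_ind: i => j; rewrite /swap.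
  by rewrite (unsplitK (inl j)) scale1r gen_phi_r phi_gen_r addrAC subrr add0r.
by rewrite (unsplitK (inr j)) scaleN1r gen_phi_l phi_gen_l opprB addrAC subrr add0r.
Qed.

(** The differential operator whose normally ordered symbol is p. *)
Definition Phi p v := ext (phi^~ v) p.

Lemma comm_Phi i p v :
  Phi p^`M(i) v =
  (if split i then 1 else -1) *: (gen (swap i) (Phi p v) - Phi p (gen (swap i) v)).
Proof.
move: p; apply: mpoly_ext_eq => [c p q|c p q|m].
- by rewrite mderivD mderivZ /Phi ext_linear.
- rewrite /Phi !ext_linear gen_lin.
  set s := if _ then _ else _; set g := gen _.
  rewrite opprD addrACA -scalerBr scalerDr !scalerA; congr (_ *: _ + _).
  by rewrite mulrC.
by rewrite mderivX /Phi extZX !extX comm_phi.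
Qed.

Lemma Phi_C (c : k) v : Phi c%:MP v = c *: v.
Proof. by rewrite -[c%:MP]mulr1 mul_mpolyC -mpolyX0 /Phi extZX phi0. Qed.

Definition Dstable (S : M -> Prop) := subspace S /\ forall i x, S x -> S (gen i x).

(** Induction on the degree: one generator is stripped off on the left, and the correction has
    smaller degree. A constant T gives stability, T = [Gam] a degree bound. *)
Lemma phi_filtered (T : nat -> M -> Prop) d m x :
  (forall e, subspace (T e)) ->
  (forall e f y, (e <= f)%N -> T e y -> T f y) ->
  (forall i e y, T e y -> T e.+1 (gen i y)) ->
  T d x -> T (mdeg m + d)%N (phi m x).
Proof.
move=> hT mono hgen hx; have [e] := ubnP (mdeg m); elim: e m => // e IH m hm.
have [->|/mnm_neq0 [i mi]] := eqVneq m 0%MM; first by rewrite phi0 mdeg0.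
pose m1 := (m - U_(i))%MM.
have e1 : m = (m1 + U_(i))%MM by rewrite submK // lep1mP.
have dm : mdeg m = (mdeg m1).+1 by rewrite {1}e1 mdegD mdeg1 addn1.
have [c [m' [lm' E]]] := gen_phi i m1 x.
move: E; rewrite -e1 => /(canLR (addrK _)) <-.
apply: subspaceB => //; first by rewrite dm addSn; apply/hgen/IH; lia.
by apply: subspaceZ => //; apply: (@mono (mdeg m' + d)%N); [lia | apply: IH; lia].
Qed.

Lemma phi_stable S m x : Dstable S -> S x -> S (phi m x).
Proof.
move=> [hS hg] sx.
exact: (@phi_filtered (fun _ => S) 0%N m x (fun _ => hS) (fun _ _ _ _ => id) (fun i _ => hg i) sx).
Qed.

Section Bernstein.
Hypothesis hchar : [pchar k] =i pred0.
Variable ops : seq (M -> M).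
Hypothesis gen_ops : forall i, List.In (gen i) ops.

(** When [ops] lists exactly the generators, this is the Bernstein filtration applied to M0. *)
Definition Gam (M0 : seq M) d := lspan (fun x => x \in words ops M0 d).

Lemma Gam_sub M0 d : subspace (Gam M0 d).
Proof. exact: lspan_sub. Qed.

Lemma Gam_leq M0 d e x : (d <= e)%N -> Gam M0 d x -> Gam M0 e x.
Proof.
by move=> de; apply: lspan_trans => y /(mem_words_leq de); apply: lspan_incl.
Qed.

Lemma Gam_gen M0 d i x : Gam M0 d x -> Gam M0 d.+1 (gen i x).
Proof.
apply: (lin_lspan (@gen_lin i)) => y hy; apply: lspan_incl.
exact: mem_words_op.
Qed.

Lemma Gam_phi M0 d m x : Gam M0 d x -> Gam M0 (mdeg m + d) (phi m x).
Proof.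
apply: (@phi_filtered (Gam M0)) => [e|e f y|i e y]; first exact: Gam_sub.
  exact: Gam_leq.
exact: Gam_gen.
Qed.

(* Bernstein's argument: an operator of degree at most [d] that sends
   [Gam [:: v] d] into [S] vanishes, as its iterated commutators with the
   generators are again such operators, down to a constant. *)
Lemma bernstein_inj (S : M -> Prop) v d p :
  Dstable S -> ~ S v -> (forall m, p@_m != 0 -> (mdeg m <= d)%N) ->
  (forall x, Gam [:: v] d x -> S (Phi p x)) -> p = 0.
Proof.
move=> [hS hgen] Sv.
(* A nonzero constant would put v itself into S. *)
have hC e q : (forall x, Gam [:: v] e x -> S (Phi q x)) -> q = (q@_0)%:MP -> q = 0.
  move=> hx; move: (q@_0) => c qc; rewrite {}qc in hx *.
  have [->|c0] := eqVneq c 0; first by rewrite mpolyC0.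
  case: Sv; rewrite -[v]scale1r -(mulVf c0) -scalerA; apply: subspaceZ => //.
  rewrite -Phi_C; apply: hx; apply: (@Gam_leq _ 0) => //.
  by apply: lspan_incl; rewrite /= inE.
elim: d p => [|d IH] p hp hx; apply: (hC _ _ hx).
  apply: msize1_polyC; rewrite msizeE; apply/bigmax_leqP_seq => m mp _.
  by apply: hp; rewrite -mcoeff_msupp.
(* All partial derivatives of the symbol vanish by induction, so the symbol is constant. *)
apply: mderiv_eq0 => // i; apply: IH => [m|x Gx].
  rewrite mcoeff_deriv => nz; rewrite -ltnS -addn1 -[1%N](mdeg1 i) -mdegD.
  by apply: hp; apply: contraNneq nz => ->; rewrite mul0rn.
rewrite comm_Phi; apply: subspaceZ => //; apply: subspaceB => //.
  by apply: hgen; apply: hx; apply: Gam_leq Gx.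
by apply: hx; apply: Gam_gen.
Qed.

Definition mbox q (f : {ffun 'I_(n + n) -> 'I_q}) : 'X_{1..n + n} := [multinom (f i : nat) | i < n + n].

Lemma mbox_inj q : injective (@mbox q).
Proof.
move=> f g e; apply/ffunP => i; apply: val_inj.
by move/mnmP: e => /(_ i); rewrite !mnmE.
Qed.

Lemma mdeg_mbox q f : (mdeg (@mbox q f) <= (n + n) * q)%N.
Proof.
rewrite mdegE -[X in (X * q)%N]card_ord -sum_nat_const; apply: leq_sum => i _.
by rewrite mnmE ltnW.
Qed.

(** With d = 2nq, let s and s' be bases of [Gam [:: v] d] and [Gam [:: v] (d + d)] modulo S. The
    q^(2n) monomials with exponents below q map the first space to the second and are independent as
    maps modulo S, so q^(2n) <= |s| |s'| <= |s'|^2. *)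
Lemma bernstein (S : M -> Prop) v q : Dstable S -> ~ S v ->
  exists F : 'I_(q ^ n) -> M, indep S F /\ forall i, Gam [:: v] (4 * n * q) (F i).
Proof.
move=> hD Sv; have hS := hD.1; pose d := ((n + n) * q)%N.
have -> : (4 * n * q = d + d)%N by rewrite /d; lia.
have [s [si ss st]] := indep_basis (words ops [:: v] d) hS.
have [s' [si' ss' st']] := indep_basis (words ops [:: v] (d + d)) hS.
have Gs (i : 'I_(size s)) : Gam [:: v] d s`_i by apply: lspan_incl; apply: ss; apply: mem_nth.
have span' x : Gam [:: v] (d + d) x -> spanned S (fun i : 'I_(size s') => s'`_i) x.
  by apply; [apply: spanned_sub | apply: st'].
have spans x : Gam [:: v] d x -> spanned S (fun i : 'I_(size s) => s`_i) x.
  by apply; [apply: spanned_sub | apply: st].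
have le : (size s <= size s')%N.
  rewrite -[X in (X <= _)%N]card_ord -[X in (_ <= X)%N]card_ord.
  apply: (indep_leq_card hS si) => i; apply: span'.
  by apply: Gam_leq (Gs i); rewrite leq_addr.
have bnd : (q ^ (n + n) <= size s * size s')%N.
  rewrite leqNgt; apply/negP => lt.
  have hx (x : {ffun 'I_(n + n) -> 'I_q} * 'I_(size s)) :
      spanned S (fun j : 'I_(size s') => s'`_j) (phi (mbox x.1) s`_(x.2)).
    have hx := Gam_phi (m := mbox x.1) (Gs x.2).
    by apply: span'; apply: Gam_leq hx; rewrite leq_add2r mdeg_mbox.
  have [C hC] := choice_fun hx.
  (* With too many monomials, some nontrivial combination has zero matrix from s to s', hence sends
     [Gam [:: v] d] into S, against [bernstein_inj]. *)
  have [|u [[f0 uf0] hu]] := @lin_dep k {ffun 'I_(n + n) -> 'I_q}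
      ('I_(size s) * 'I_(size s'))%type (fun f ij => C (f, ij.1) ij.2).
    by rewrite card_prod card_ffun !card_ord.
  have p0 : \sum_f u f *: 'X_[mbox f] = 0 :> {mpoly k[n + n]}.
    apply: (@bernstein_inj S v d) => // [m|x Gx].
      rewrite raddf_sum /= => nz.
      have [f ef] : exists f : {ffun 'I_(n + n) -> 'I_q}, mbox f = m.
        apply: NNPP => h; case/eqP: nz; apply: big1 => f _.
        rewrite mcoeffZ mcoeffX; have [e|_] := eqVneq (mbox f) m; last by rewrite mulr0.
        by case: h; exists f.
      by rewrite -ef mdeg_mbox.
    rewrite /Phi ext_sumX; have [c hc] := spans _ Gx.
    (* As A preserves S, only its values on the basis s have to be examined. *)
    pose A y := \sum_f u f *: phi (mbox f) y.
    have A_lin (a : k) y z : A (a *: y + z) = a *: A y + A z.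
      rewrite /A scaler_sumr -big_split /=; apply: eq_bigr => f _.
      by rewrite phi_lin scalerDr !scalerA mulrC.
    have A_S y : S y -> S (A y).
      move=> sy; apply: subspace_sum => // f _; apply: subspaceZ => //.
      exact: phi_stable.
    rewrite -/(A x) -(subrK (\sum_j c j *: s`_j) x) (linD A_lin) (lin_sum A_lin).
    apply: subspaceD => //; first exact: A_S.
    apply: subspace_sum => // j _; rewrite (linZ A_lin); apply: subspaceZ => //.
    have e0 : \sum_f u f *: \sum_j' C (f, j) j' *: s'`_j' = 0.
      rewrite (eq_bigr _ (fun i _ => scaler_sumr _ _ _ _)) exchange_big big1 //= => j' _.
      rewrite (eq_bigr _ (fun i _ => scalerA _ _ _)) -scaler_suml (hu (j, j')) scale0r //.
    rewrite -[A _]subr0 -[X in _ - X]e0 -sumrB; apply: subspace_sum => // f _.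
    by rewrite -scalerBr; apply: subspaceZ => //; exact: (hC (f, j)).
  case/eqP: uf0; have := congr1 (mcoeff (mbox f0)) p0.
  rewrite mcoeff0 raddf_sum /= (bigD1 f0) //= big1 ?addr0 => [|f nf].
    by rewrite mcoeffZ mcoeffX eqxx mulr1.
  by rewrite mcoeffZ mcoeffX (inj_eq (@mbox_inj _)) (negbTE nf) mulr0.
have qs' : (q ^ n <= size s')%N.
  rewrite -(@leq_exp2r _ _ 2) // -expnM muln2 -addnn; apply: leq_trans bnd _.
  by rewrite expnS expn1 leq_mul2r le orbT.
exists (fun i => s'`_(widen_ord qs' i)); split; last first.
  by move=> i; apply: lspan_incl; apply: ss'; apply: mem_nth.
apply: (@indep_inj _ _ S 'I_(size s') _ (fun i => s'`_i)) si' => i j e.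
by apply: val_inj; move/(congr1 val): e.
Qed.


End Bernstein.
End Weyl.

(** * Standard monomials *)

Section StandardMonomials.
Variables (k : fieldType) (n : nat) (M : lmodType k).
Variables (mulA : {mpoly k[n]} -> M -> M) (D : 'I_n -> M -> M).
Hypothesis W : weyl_module mulA D.
Variables (ops : seq (M -> M)) (M0 : seq M).
Hypothesis gen_ops : forall i, List.In (gen mulA D i) ops.
Hypothesis ops_gen : forall op, List.In op ops -> exists i, op = gen mulA D i.

Notation phi := (phi mulA D).
Notation gen := (gen mulA D).
Notation Gam := (Gam ops M0).
Implicit Types m : 'X_{1..n + n}.

(** Terms are ordered by the degree-compatible monomial order, then by the index of the module
    generator. *)
Definition plt m' l m j := ((m' < m)%O || ((m' == m) && (l < j)%N)).

Definition lower m j := lspan (fun x => exists m' l,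
  [/\ plt m' l m j, (l < size M0)%N & x = phi m' M0`_l]).

(** Such a pair is the leading term of a relation, as for initial modules in Groebner basis
    theory. *)
Definition nonstandard m j := lower m j (phi m M0`_j).

Lemma plt_mdeg m' l m j : plt m' l m j -> (mdeg m' <= mdeg m)%N.
Proof. by case/orP => [/ltW /lemc_mdeg //|/andP [/eqP -> _]]. Qed.

Lemma gen_lower i m j x : lower m j x -> lower (m + U_(i))%MM j (gen i x).
Proof.
apply: (lin_lspan (gen_lin W i)) => y [m' [l [lt lM ->]]].
have [c [m'' [le ->]]] := gen_phi W i m' M0`_l.
apply: lspanD.
  apply: lspan_incl; exists (m' + U_(i))%MM, l; split=> //.
  by rewrite /plt ltmc_add2l eqm_add2r.
apply: lspanZ.
apply: lspan_incl; exists m'', l; split=> //.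
rewrite /plt lt_mdeg_ltmc // mdegD mdeg1 addn1 ltnS.
exact: leq_trans le (plt_mdeg lt).
Qed.

(** Applying a generator to a relation shifts its leading term, because the correction of [gen_phi]
    has smaller degree. The nonstandard exponents thus form a monomial ideal for each j. *)
Lemma nonstandard_gen i m j : (j < size M0)%N ->
  nonstandard m j -> nonstandard (m + U_(i))%MM j.
Proof.
move=> jM h; have := gen_lower (i := i) h; rewrite /nonstandard.
have [c [m'' [le ->]]] := gen_phi W i m M0`_j.
apply: lspan_addr.
apply: lspanZ.
apply: lspan_incl; exists m'', j; split=> //.
by rewrite /plt lt_mdeg_ltmc // mdegD mdeg1 addn1 ltnS.
Qed.

Lemma nonstandard_lep m m' j : (j < size M0)%N ->
  (m <= m')%MM -> nonstandard m j -> nonstandard m' j.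
Proof.
move=> jM le; rewrite -(submK le) addmC => hm.
elim/mnm_ind: (m' - m)%MM => [|e i IH]; first by rewrite addm0.
by rewrite addmA; apply: nonstandard_gen.
Qed.

(** An exponent on the coordinate face selected by h. Summing over fibres avoids an inverse of h and
    gives 0 off its image. *)
Definition mface (h : 'I_n.+1 -> 'I_(n + n)) (f : 'I_n.+1 -> nat) : 'X_{1..n + n} :=
  [multinom (\sum_(s | h s == i) f s)%N | i < n + n].

Lemma mfaceE h f s : injective h -> mface h f (h s) = f s.
Proof.
move=> hi; rewrite mnmE (big_pred1 s) // => s'.
by rewrite /= (inj_eq hi).
Qed.

Lemma mdeg_mface h f : mdeg (mface h f) = (\sum_s f s)%N.
Proof.
rewrite mdegE [RHS](partition_big h predT) //=.
by apply: eq_bigr => i _; rewrite mnmE.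
Qed.

Lemma mface_lep h f m : injective h -> (forall s, f s <= m (h s))%N -> (mface h f <= m)%MM.
Proof.
move=> hi le; apply/mnm_lepP => i; have [/existsP [s /eqP <-]|] := boolP [exists s, h s == i].
  by rewrite mfaceE.
rewrite negb_exists => /forallP nh; rewrite mnmE big_pred0 // => s.
by rewrite (negbTE (nh s)).
Qed.

(** Standard monomials are independent, and a face of dimension n+1 contains q^(n+1) of them with
    exponents below q. *)
Lemma standard_face_growth h j q : injective h -> (j < size M0)%N ->
  (forall f, ~ nonstandard (mface h f) j) ->
  exists (I : finType) (F : I -> M),
    [/\ #|I| = (q ^ n.+1)%N, indep (eq 0) F & forall i, Gam (n.+1 * q) (F i)].
Proof.
move=> hi jM std; pose mf (f : {ffun 'I_n.+1 -> 'I_q}) := mface h (fun s => f s).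
exists {ffun 'I_n.+1 -> 'I_q}, (fun f => phi (mf f) M0`_j); split.
- by rewrite card_ffun !card_ord.
- move=> c hc f1; apply: NNPP => /eqP f1P.
  (* The largest monomial occurring in a relation would be nonstandard. *)
  case: (@Order.TotalTheory.arg_maxP _ _ _ f1 (fun f => c f != 0) mf f1P) => f0 c0 fmax.
  apply: (std (fun s => f0 s)); rewrite /nonstandard -/(mf f0).
  have -> : phi (mf f0) M0`_j = - (c f0)^-1 *: \sum_(f | f != f0) c f *: phi (mf f) M0`_j.
    move: hc; rewrite (bigD1 f0) //= => /esym/eqP; rewrite addr_eq0 => /eqP e.
    by rewrite scaleNr -scalerN -[X in _ *: X]opprK -e opprK scalerA mulVf // scale1r.
  apply: lspanZ.
  apply: lspan_sum => f ff0.
  have [->|cf] := eqVneq (c f) 0; first by rewrite scale0r; apply: (lspan_sub _).1.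
  apply: lspanZ.
  apply: lspan_incl; exists (mf f), j; split=> //.
  have fm : (mf f <= mf f0)%O := fmax _ cf.
  rewrite /plt lt_neqAle fm andbT; apply/orP; left.
  apply: contraNneq ff0 => e; apply/eqP/ffunP => s; apply: val_inj.
  by have := mfaceE (fun s => f s) s hi; rewrite -/(mf f) e mfaceE.
move=> f; have hg : Gam 0 M0`_j by apply: lspan_incl; apply: mem_nth.
apply: (Gam_leq _ (Gam_phi W gen_ops (m := mf f) hg)).
rewrite addn0 mdeg_mface -[X in (X * q)%N]card_ord -sum_nat_const.
by apply: leq_sum => s _; apply: ltnW.
Qed.

(** There are finitely many pairs (h, j), so the largest exponent among their nonstandard face
    monomials serves them all. *)
Lemma uniform_nonstandard :
  (forall (h : 'I_n.+1 -> 'I_(n + n)) j, injective h -> (j < size M0)%N ->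
    exists f, nonstandard (mface h f) j) ->
  exists a, forall (h : 'I_n.+1 -> 'I_(n + n)) j m, injective h -> (j < size M0)%N ->
    (forall s, a <= m (h s))%N -> nonstandard m j.
Proof.
move=> hns.
have : forall x : {ffun 'I_n.+1 -> 'I_(n + n)} * 'I_(size M0), exists f,
    injective x.1 -> nonstandard (mface x.1 f) x.2.
  move=> [h j]; have [hi|hi] := classic (injective h).
    by have [f hf] := hns h j hi (ltn_ord j); exists f.
  by exists (fun _ => 0%N).
case/choice_fun => f hf; exists (\max_x \max_s f x s)%N => h j m hi jM hm.
have hi' : injective [ffun s => h s] by move=> s t; rewrite !ffunE => /hi.
apply: (nonstandard_lep jM _ (hf ([ffun s => h s], Ordinal jM) hi')).
apply: mface_lep => //= s; rewrite ffunE; apply: leq_trans (hm s).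
set x := (_, _) : {ffun 'I_n.+1 -> 'I_(n + n)} * 'I_(size M0).
apply: leq_trans (leq_bigmax (F := fun x => \max_s f x s) x).
exact: (leq_bigmax (F := f x)).
Qed.

Section Bound.
Variable a : nat.
Hypothesis ha : forall (h : 'I_n.+1 -> 'I_(n + n)) j m, injective h -> (j < size M0)%N ->
    (forall s, a <= m (h s))%N -> nonstandard m j.

Definition few m := (#|[set i | a <= m i]| <= n)%N.

Lemma few_or_nonstandard m j : (j < size M0)%N -> few m \/ nonstandard m j.
Proof.
move=> jM; have [|lt] := leqP #|[set i | (a <= m i)%N]| n; [by left | right].
apply: (ha (h := fun s => enum_val (widen_ord lt s))) => // [s t /enum_val_inj /(congr1 val) /= e|s].
  exact: val_inj.
by have := enum_valP (widen_ord lt s); rewrite inE.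
Qed.

(** Reduction to normal form: a term with more than n exponents of size at least [a] is nonstandard,
    and is rewritten by smaller terms. The order is well-founded and degrees never increase. *)
Lemma few_span m j : (j < size M0)%N ->
  lspan (fun x => exists m' l,
    [/\ few m', (mdeg m' <= mdeg m)%N, (l < size M0)%N & x = phi m' M0`_l]) (phi m M0`_j).
Proof.
elim/(ltmwf (n := n + n)): m j => m IH j; have [b] := ubnP j; elim: b j => // b IHb j jb jM.
have [fm|] := few_or_nonstandard m jM.
  by apply: lspan_incl; exists m, j.
apply: lspan_trans => y [m' [l [lt lM ->]]].
case/orP: (lt) => [lt'|/andP [/eqP -> lj]].
  have := IH m' lt' l lM; apply: lspan_trans => z [m'' [l' [h1 h2 h3 h4]]].
  apply: lspan_incl; exists m'', l'; split=> //; apply: leq_trans h2 (plt_mdeg lt).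
by apply: IHb => //; lia.
Qed.

Definition few_code d : finType :=
  ({ffun 'I_n -> option 'I_(n + n)} * {ffun 'I_n -> 'I_d.+1} *
   {ffun 'I_(n + n) -> 'I_a.+1} * 'I_(size M0))%type.

Definition few_decode d (t : few_code d) : 'X_{1..n + n} :=
  [multinom (if [pick s | t.1.1.1 s == Some i] is Some s then t.1.1.2 s : nat
             else t.1.2 i) | i < n + n].

Lemma few_decode_surj d m j : few m -> (mdeg m <= d)%N -> (j < size M0)%N ->
  exists t : few_code d, m = few_decode t /\ t.2 = j :> nat.
Proof.
move=> fm md jM; set A := [set i | (a <= m i)%N] in fm.
pose h := [ffun s : 'I_n => nth None [seq Some i | i <- enum A] s].
pose u := [ffun s : 'I_n => inord (if h s is Some i then m i else 0) : 'I_d.+1].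
pose w := [ffun i : 'I_(n + n) => inord (m i) : 'I_a.+1].
exists (h, u, w, Ordinal jM); split=> //; apply/mnmP => i; rewrite mnmE /=.
have mi : (m i <= d)%N by apply: leq_trans md; rewrite mdegE (bigD1 i) //= leq_addr.
case: pickP => [s /eqP hs|hn].
  by rewrite ffunE hs inordK.
rewrite ffunE inordK // ltnS leqNgt; apply/negP => /ltnW ai.
have iA : i \in enum A by rewrite mem_enum inE.
have lt : (index i (enum A) < n)%N.
  by apply: leq_trans fm; rewrite cardE index_mem.
have := hn (Ordinal lt); rewrite ffunE (nth_map i) ?index_mem // nth_index //.
by rewrite eqxx.
Qed.

Lemma few_bound d : exists (J : finType) (G : J -> M),
  #|J| = ((n + n).+1 ^ n * d.+1 ^ n * a.+1 ^ (n + n) * size M0)%N /\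
  forall x, Gam d x -> spanned (eq 0) G x.
Proof.
exists (few_code d), (fun t => phi (few_decode t) M0`_(t.2)); split.
  by rewrite !card_prod !card_ffun card_option !card_ord.
move=> x hx.
have : lspan (fun x => exists m' l,
    [/\ few m', (mdeg m' <= d)%N, (l < size M0)%N & x = phi m' M0`_l]) x.
  (* Words of length at most d are first brought into normal order, within degree d. *)
  have : lspan (fun x => exists m' l,
      [/\ (mdeg m' <= d)%N, (l < size M0)%N & x = phi m' M0`_l]) x.
    apply: lspan_trans hx => y; elim: d y => [|d IH] y.
      move=> /(nthP 0) [l lM <-]; apply: lspan_incl; exists 0%MM, l.
      by split=> //; rewrite ?mdeg0 ?(phi0 W).
    case/mem_wordsS_inv => [/IH|[op [z [/ops_gen [i ->] /IH hz ->]]]].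
      apply: lspan_trans => z [m' [l [h1 h2 h3]]]; apply: lspan_incl; exists m', l.
      by split=> //; apply: leqW.
    apply: (lin_lspan (gen_lin W i)) hz => _ [m' [l [h1 h2 ->]]].
    have [c [m'' [le ->]]] := gen_phi W i m' M0`_l.
    apply: lspanD.
      by apply: lspan_incl; exists (m' + U_(i))%MM, l; rewrite mdegD mdeg1 addn1.
    apply: lspanZ.
    apply: lspan_incl; exists m'', l; split=> //.
    by apply: leq_trans le _; apply: leqW.
  apply: lspan_trans => _ [m' [l [h1 h2 ->]]].
  have := few_span (m := m') h2; apply: lspan_trans => y [m'' [l' [p1 p2 p3 p4]]].
  by apply: lspan_incl; exists m'', l'; split=> //; apply: leq_trans h1.
apply: lspan_spanned => y [m' [l [p1 p2 p3 ->]]].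
have [t [-> <-]] := few_decode_surj p1 p2 p3.
by exists t.
Qed.

End Bound.

Lemma Gam_poly_bound :
  ~ (forall q, (0 < q)%N -> exists (I : finType) (F : I -> M),
    [/\ #|I| = (q ^ n.+1)%N, indep (eq 0) F & forall i, Gam (n.+1 * q) (F i)]) ->
  exists K, forall d, exists (J : finType) (G : J -> M),
    (#|J| <= K * d.+1 ^ n)%N /\ forall x, Gam d x -> spanned (eq 0) G x.
Proof.
move=> hno.
have [a ha] : exists a, forall (h : 'I_n.+1 -> 'I_(n + n)) j m, injective h -> (j < size M0)%N ->
    (forall s, a <= m (h s))%N -> nonstandard m j.
  apply: uniform_nonstandard => h j hi jM; apply: NNPP => nex; apply: hno => q _.
  by apply: (standard_face_growth q hi jM) => f hf; apply: nex; exists f.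
exists ((n + n).+1 ^ n * a.+1 ^ (n + n) * size M0)%N => d.
have [J [G [cJ hG]]] := few_bound ha d; exists J, G; split=> //.
by rewrite cJ; apply: eq_leq; ring.
Qed.

End StandardMonomials.

(** * Derivations of the polynomial ring *)

Section Derivations.
Variables (k : fieldType) (n : nat).
Notation A := {mpoly k[n]}.

Lemma is_der_combination (I : Type) (r : seq I) (p : I -> A) (l : I -> 'I_n) :
  is_der (fun f : A => \sum_(i <- r) p i * f^`M(l i)).
Proof.
split=> [c f g|f g].
  rewrite scaler_sumr -big_split /=; apply: eq_bigr => i _.
  by rewrite mderivD mderivZ mulrDr scalerAr.
rewrite mulr_suml mulr_sumr -big_split /=; apply: eq_bigr => i _.
by rewrite mderivM; ring.
Qed.

Lemma is_der_mul (p : A) i : is_der (fun f : A => p * f^`M(i)).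
Proof.
have := is_der_combination [:: tt] (fun _ => p) (fun _ => i).
by case=> h1 h2; split=> [c f g|f g]; [have := h1 c f g | have := h2 f g];
  rewrite !big_seq1.
Qed.

Lemma is_der0 : is_der (fun _ : A => 0 : A).
Proof. by split=> *; rewrite ?scaler0 ?mul0r ?mulr0 addr0. Qed.

Lemma is_der_comb (c : k) (d1 d2 : A -> A) : is_der d1 -> is_der d2 ->
  is_der (fun f => c *: d1 f + d2 f).
Proof.
move=> [l1 m1] [l2 m2]; split=> [e f g|f g].
  by rewrite l1 l2 !scalerDr !scalerA mulrC addrACA.
by rewrite m1 m2 !scalerDr mulrDl mulrDr scalerAl scalerAr addrACA.
Qed.

Lemma is_der_bracket (d1 d2 : A -> A) : is_der d1 -> is_der d2 ->
  is_der (fun f => d1 (d2 f) - d2 (d1 f)).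
Proof.
move=> [l1 m1] [l2 m2]; split=> [c f g|f g].
  by rewrite l2 l1 l1 l2 scalerBr opprD addrACA.
have a1 := linD l1; have a2 := linD l2.
by rewrite m2 m1 a1 a2 !m1 !m2; ring.
Qed.

Lemma der_ext (d1 d2 : A -> A) : is_der d1 -> is_der d2 ->
  (forall i, d1 'X_i = d2 'X_i) -> forall f, d1 f = d2 f.
Proof.
move=> [l1 m1] [l2 m2] hX.
have d1' (d : A -> A) (md : forall f g, d (f * g) = d f * g + f * d g) : d 1 = 0.
  have := md 1 1; rewrite !mulr1 !mul1r => /(canLR (addrK _)).
  by rewrite subrr => ->.
apply: mpoly_ext_eq => // m; elim/mnm_ind: m => [|m i IH].
  by rewrite mpolyX0 !d1'.
by rewrite mpolyXD m1 m2 IH hX.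
Qed.

Lemma der_sum (d : A -> A) : is_der d ->
  forall f, d f = \sum_i d 'X_i * f^`M(i).
Proof.
move=> hd; apply: der_ext => // [|i].
  exact: (is_der_combination (index_enum 'I_n) (fun i => d 'X_i) id).
rewrite (bigD1 i) //= big1 ?addr0 => [|j ji]; rewrite mderivX mnm1E.
  by rewrite eqxx scale1r -[X in 'X_[X - _]]add0m addmK mpolyX0 mulr1.
by rewrite eq_sym (negbTE ji) scale0r mulr0.
Qed.

Definition xder (a : 'X_{1..n}) (i : 'I_n) : A -> A := fun f => 'X_[a] * f^`M(i).

Lemma is_der_xder a i : is_der (xder a i).
Proof. exact: is_der_mul. Qed.

Lemma xder_comp a b i j f : xder a i (xder b j f) =
  (b i)%:R *: xder (a + b - U_(i))%MM j f + 'X_[a + b] * f^`M(j)^`M(i).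
Proof.
rewrite /xder mderivM mderivX mulrDr mpolyXD mulrA -scalerAl -scalerAr mulrA.
congr (_ + _); have [->|bi] := eqVneq (b i) 0%N; first by rewrite !scale0r.
by rewrite -mpolyXD addmBA // lep1mP.
Qed.

(** The second-order terms of the two compositions cancel. *)
Lemma xder_bracket a b i j f :
  xder a i (xder b j f) - xder b j (xder a i f) =
  (b i)%:R *: xder (a + b - U_(i))%MM j f - (a j)%:R *: xder (a + b - U_(j))%MM i f.
Proof.
rewrite !xder_comp (addmC b a) mderiv_comm opprD addrACA subrr addr0 //.
Qed.

End Derivations.

(** * Polynomial vector fields acting on a module *)

Section AVModule.
Variables (k : fieldType) (n : nat) (M : lmodType k).
Variables (mulA : {mpoly k[n]} -> M -> M).
Variables (actV : ({mpoly k[n]} -> {mpoly k[n]}) -> M -> M).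
Hypothesis hAV : is_AVmodule mulA actV.
Notation A := {mpoly k[n]}.

Lemma actV_lin d : is_der d -> forall (c : k) (u v : M),
  actV d (c *: u + v) = c *: actV d u + actV d v.
Proof. by case: hAV => [_ [_ [_ [_ [_ [h _]]]]]]; apply: h. Qed.

Lemma actV_comb d1 d2 d3 (c : k) : is_der d1 -> is_der d2 -> is_der d3 ->
     (forall f, d3 f = c *: d1 f + d2 f) ->
     forall m, actV d3 m = c *: actV d1 m + actV d2 m.
Proof. by case: hAV => [_ [_ [_ [_ [_ [_ [h _]]]]]]]; apply: h. Qed.

Lemma actV_bracket d1 d2 d3 : is_der d1 -> is_der d2 -> is_der d3 ->
     (forall f, d3 f = d1 (d2 f) - d2 (d1 f)) ->
     forall m, actV d3 m = actV d1 (actV d2 m) - actV d2 (actV d1 m).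
Proof. by case: hAV => [_ [_ [_ [_ [_ [_ [_ [h _]]]]]]]]; apply: h. Qed.

Lemma actV_leibniz d f m : is_der d ->
  actV d (mulA f m) = mulA (d f) m + mulA f (actV d m).
Proof. by case: hAV => [_ [_ [_ [_ [_ [_ [_ [_ h]]]]]]]]; apply: h. Qed.

Lemma actV0 d m : is_der d -> (forall f, d f = 0) -> actV d m = 0.
Proof.
move=> hd d0; have h f : d f = 1 *: d f + d f by rewrite d0 scaler0 addr0.
have := actV_comb hd hd hd h m; rewrite scale1r => /eqP.
by rewrite -subr_eq0 opprD addrA subrr sub0r oppr_eq0 => /eqP.
Qed.

(** The action takes functions as arguments; its independence of their presentation follows from
    linearity, with the zero derivation as second summand. *)
Lemma actV_ext d1 d2 m : is_der d1 -> is_der d2 -> (forall f, d1 f = d2 f) ->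
  actV d1 m = actV d2 m.
Proof.
move=> h1 h2 e; have h0 := @is_der0 k n.
rewrite (actV_comb (c := 1) h2 h0 h1) ?(actV0 _ h0) ?scale1r ?addr0 // => f.
by rewrite scale1r addr0.
Qed.

Lemma actV_xder_bracket a b i j m :
  actV (xder a i) (actV (xder b j) m) - actV (xder b j) (actV (xder a i) m) =
  (b i)%:R *: actV (xder (a + b - U_(i))%MM j) m
  - (a j)%:R *: actV (xder (a + b - U_(j))%MM i) m.
Proof.
have ha := is_der_xder k a i; have hb := is_der_xder k b j.
have h1 := is_der_xder k (a + b - U_(i))%MM j.
have h2 := is_der_xder k (a + b - U_(j))%MM i.
have h0 := @is_der0 k n; have hB := is_der_bracket ha hb.
rewrite -(actV_bracket ha hb hB) //.
have hN := is_der_comb (- (a j)%:R) h2 h0.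
rewrite (actV_comb (c := (b i)%:R) h1 hN hB) => [|f].
  by rewrite (actV_comb (c := - (a j)%:R) h2 h0 hN) // (actV0 _ h0) // addr0 scaleNr.
by rewrite xder_bracket addr0 scaleNr.
Qed.

(** Written as a monomial field so that the bracket formula applies to it. *)
Definition pder (i : 'I_n) : A -> A := xder 0%MM i.

Lemma pderE i f : pder i f = f^`M(i).
Proof. by rewrite /pder /xder mpolyX0 mul1r. Qed.

Lemma actV_pder_bracket b i j m :
  actV (pder i) (actV (xder b j) m) - actV (xder b j) (actV (pder i) m) =
  (b i)%:R *: actV (xder (b - U_(i))%MM j) m.
Proof. by rewrite actV_xder_bracket mnm0E scale0r subr0 add0m. Qed.

Lemma AV_weyl : weyl_module mulA (fun i => actV (pder i)).
Proof.
case: (hAV) => h1 [h2 [h3 [h4 [h5 _]]]]; split=> //.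
- by move=> i; apply/actV_lin/is_der_xder.
- move=> i j v; apply/eqP; rewrite -subr_eq0 actV_pder_bracket mnm0E scale0r //.
- by move=> i f v; rewrite actV_leibniz ?pderE //; apply: is_der_xder.
Qed.

(* For u = x_j x_i d_i and w = x^b d_i one has
   [u, w] = (b_i - 1 - (i == j)) x^(b + e_j) d_i; for every monomial x^a of
   degree at least 4 some x_j dividing it makes the coefficient nonzero. *)
Lemma AVsub_crit (S : M -> Prop) : [pchar k] =i pred0 -> subspace S ->
  (forall i x, S x -> S (mulA 'X_i x)) ->
  (forall a i x, (mdeg a <= 3)%N -> S x -> S (actV (xder a i) x)) ->
  is_AVsub mulA actV S.
Proof.
move=> hchar hS hX hV; split; [by case: hS|split; [by case: hS|split]].
  have [_ [h2 [h3 [h4 [h5 _]]]]] := hAV.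
  have hm m x : S x -> S (mulA 'X_[m] x).
    elim/mnm_ind: m => [|m i IH] sx; first by rewrite mpolyX0 h5.
    by rewrite addmC mpolyXD h4; apply/hX/IH.
  elim/mpolyind=> [x sx|c m p _ _ IH x sx].
    by rewrite -(scale0r 1) h3 scale0r; case: hS.
  by rewrite h2 h3; apply: subspaceD => //; [apply: subspaceZ => //; apply: hm | apply: IH].
have hall a i x : S x -> S (actV (xder a i) x).
  have [d] := ubnP (mdeg a); elim: d a i x => // d IH a i x ad sx.
  have [|a4] := leqP (mdeg a) 3; first by move=> a3; apply: hV.
  have [j [aj nz]] : exists j, (0 < a j)%N /\ (a - U_(j))%MM i != (i == j).+1.
    (* If a_i is neither 0 nor 3, take j = i: then b_i = a_i - 1 differs from 2. Otherwise degree at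
       least 4 forces another variable x_j, and b_i = a_i differs from 1. *)
    have [hi|hi] := boolP ((a i != 0%N) && (a i != 3)).
      exists i; rewrite mnmBE mnm1E eqxx; split; lia.
    have [j /andP [ji aj]] : exists j, (j != i) && (0 < a j)%N.
      apply: NNPP => nex; have : mdeg a = a i.
        rewrite mdegE (bigD1 i) //= big1 ?addn0 // => j ji.
        apply/eqP; rewrite -leqn0 leqNgt; apply/negP => aj; apply: nex; exists j.
        by rewrite ji.
      by move: hi a4; lia.
    exists j; rewrite mnmBE mnm1E [i == j]eq_sym (negbTE ji); split=> //; lia.
  pose b := (a - U_(j))%MM.
  have ab : a = (b + U_(j))%MM by rewrite submK // lep1mP -lt0n.
  (* Both factors of the bracket have degree below that of x^a, so induction covers them. *)
  have db : (mdeg b < d)%N by move: ad; rewrite {1}ab mdegD mdeg1; lia.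
  have du : (mdeg (U_(j) + U_(i))%MM < d)%N by rewrite mdegD !mdeg1; lia.
  have := actV_xder_bracket (U_(j) + U_(i))%MM b i i x.
  have -> : (U_(j) + U_(i) + b - U_(i))%MM = a.
    rewrite ab; apply/mnmP => l; rewrite !(mnmBE, mnmDE, mnm1E); lia.
  rewrite -scalerBl mnmDE !mnm1E eqxx addn1 eq_sym => E.
  have cnz : (b i)%:R - (i == j).+1%:R != 0 :> k.
    move/pcharf0P: hchar => h0; rewrite subr_eq0.
    have [lt|lt|e] := ltngtP (b i) (i == j).+1; last by rewrite /b e eqxx in nz.
      by rewrite eq_sym -subr_eq0 -natrB ?(ltnW lt) // h0 subn_eq0 -ltnNge.
    by rewrite -subr_eq0 -natrB ?(ltnW lt) // h0 subn_eq0 -ltnNge.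
  rewrite -[actV _ _]scale1r -(mulVf cnz) -scalerA -E.
  apply: subspaceZ => //; apply: subspaceB => //.
    by apply: (IH _ i _ du); apply: (IH _ i _ db).
  by apply: (IH _ i _ db); apply: (IH _ i _ du).
have hmul p i x : S x -> S (actV (fun f => p * f^`M(i)) x).
  move=> sx; elim/mpolyind: p => [|c m p _ _ IH].
    rewrite actV0; [by case: hS | exact: is_der_mul | by move=> f; rewrite mul0r].
  rewrite (actV_comb (c := c) (is_der_xder k m i) (is_der_mul p i) (is_der_mul _ i)).
    by apply: subspaceD => //; apply: subspaceZ => //; apply: hall.
  by move=> f; rewrite mulrDl -scalerAl.
(* A general derivation is the sum of the fields d(x_i) d_i, added one at a time. *)
move=> d x hd sx.
pose dr r : A -> A := fun f => \sum_(i <- r) d 'X_i * f^`M(i).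
have hdr r : is_der (dr r) := is_der_combination r (fun i => d 'X_i) id.
rewrite (actV_ext x hd (hdr (index_enum 'I_n)) (der_sum hd)).
elim: (index_enum _) => [|i r IH].
  rewrite actV0 //; [by case: hS | by move=> f; rewrite /dr big_nil].
rewrite (actV_comb (c := 1) (is_der_mul (d 'X_i) i) (hdr r) (hdr _)).
  by apply: subspaceD => //; apply: subspaceZ => //; apply: hmul.
by move=> f; rewrite /dr big_cons scale1r.
Qed.

End AVModule.

(** * Finite generation and finite length *)

Lemma mem_In (T : eqType) (s : seq T) x : x \in s -> List.In x s.
Proof.
by elim: s => //= y s IH; rewrite inE => /orP [/eqP ->|/IH]; [left | right].
Qed.

Lemma In_map (T U : Type) (f : T -> U) (s : seq T) x :
  List.In x s -> List.In (f x) (map f s).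
Proof. by elim: s => //= y s IH [->|/IH]; [left | right]. Qed.

Lemma In_map_inv (T U : Type) (f : T -> U) (s : seq T) y :
  List.In y (map f s) -> exists2 x, List.In x s & y = f x.
Proof.
elim: s => //= x s IH [<-|/IH [z zs ->]]; first by exists x; first by left.
by exists z; first by right.
Qed.

Lemma In_cat (T : Type) (x : T) s t :
  List.In x (s ++ t) <-> List.In x s \/ List.In x t.
Proof. by elim: s => /= [|y s IH]; [split; [right|case]|rewrite IH; tauto]. Qed.

Section DGenerated.
Variables (k : fieldType) (n : nat) (M : lmodType k).
Variables (mulA : {mpoly k[n]} -> M -> M) (D : 'I_n -> M -> M).
Hypothesis W : weyl_module mulA D.

(** The D_n-submodule generated by P. *)
Definition Dspan (P : M -> Prop) x :=
  forall S, Dstable mulA D S -> (forall y, P y -> S y) -> S x.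

Lemma Dspan_stable P : Dstable mulA D (Dspan P).
Proof.
split; first split=> [S [[h0 _] _] //|c x y hx hy S hS hP].
  by case: (hS) => [[_ h] _]; apply: h; [apply: hx | apply: hy].
by move=> i x hx S hS hP; case: (hS) => _; apply; apply: hx.
Qed.

Lemma Dspan_incl (P : M -> Prop) x : P x -> Dspan P x.
Proof. by move=> px S _; apply. Qed.

Lemma Dspan_trans (P Q : M -> Prop) x :
  (forall y, P y -> Dspan Q y) -> Dspan P x -> Dspan Q x.
Proof. by move=> h; apply => //; apply: Dspan_stable. Qed.

Lemma Dstable_mulA S f x : Dstable mulA D S -> S x -> S (mulA f x).
Proof.
move=> [hS hg] sx.
have hm m : S (mulA 'X_[m] x).
  elim/mnm_ind: m => [|m i IH]; first by rewrite mpolyX0 (wmul_1 W).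
  by rewrite addmC mpolyXD (wmul_mul W) -(gen_l mulA D); apply: hg.
elim/mpolyind: f => [|c m p _ _ IH].
  by rewrite -(scale0r 1) (wmul_scale W) scale0r; case: hS.
by rewrite (wmul_add W) (wmul_scale W); apply: subspaceD => //; apply: subspaceZ.
Qed.

Variable ops : seq (M -> M).
Hypothesis gen_ops : forall i, List.In (gen mulA D i) ops.
Hypothesis ops_gen : forall op, List.In op ops -> exists i, op = gen mulA D i.

Lemma Gam_nest M0 v d e x : Gam ops M0 e v -> Gam ops [:: v] d x -> Gam ops M0 (d + e) x.
Proof.
move=> hv; apply: lspan_trans => y; elim: d y => [|d IH] y.
  by rewrite /= inE => /eqP ->.
case/mem_wordsS_inv => [/IH|[op [z [/ops_gen [i ->] /IH hz ->]]]].
  exact: Gam_leq.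
exact: (Gam_gen W gen_ops).
Qed.

Lemma Gam_Dstable S M0 d x : Dstable mulA D S -> (forall y, y \in M0 -> S y) ->
  Gam ops M0 d x -> S x.
Proof.
move=> [hS hg] h0; apply => // y; elim: d y => [|d IH] y; first exact: h0.
by case/mem_wordsS_inv => [/IH //|[op [z [/ops_gen [i ->] /IH hz ->]]]]; apply: hg.
Qed.

Lemma Dspan_Gam M0 x : Dspan (fun y => y \in M0) x -> exists d, Gam ops M0 d x.
Proof.
move=> h; apply: (h (fun x => exists d, Gam ops M0 d x)).
  2: by move=> y hy; exists 0%N; apply: lspan_incl.
split; first split.
- by exists 0%N; apply: (Gam_sub ops M0 0).1.
- move=> c y z [d hy] [e hz]; exists (d + e)%N; apply: (Gam_sub ops M0 _).2.
    by apply: Gam_leq hy; apply: leq_addr.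
  by apply: Gam_leq hz; apply: leq_addl.
by move=> i y [d hy]; exists d.+1; apply: (Gam_gen W gen_ops).
Qed.

Hypothesis hchar : [pchar k] =i pred0.

(** Bernstein's inequality for v i modulo S i gives q^n vectors, which lie in S i.+1; the layers are
    independent together. *)
Lemma chain_growth (S : nat -> M -> Prop) (v : nat -> M) l q :
  (forall i, (i <= l)%N -> Dstable mulA D (S i)) ->
  (forall i x, (i < l)%N -> S i x -> S i.+1 x) ->
  (forall i, (i < l)%N -> S i.+1 (v i) /\ ~ S i (v i)) ->
  exists F : 'I_l * 'I_(q ^ n) -> M,
    indep (eq 0) F /\ forall p : 'I_l * 'I_(q ^ n), Gam ops [:: v p.1] (4 * n * q) (F p).
Proof.
move=> hS mono hv.
have hF i : exists F : 'I_(q ^ n) -> M, (i < l)%N ->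
    indep (S i) F /\ forall j, Gam ops [:: v i] (4 * n * q) (F j).
  have [il|il] := ltnP i l; last by exists (fun _ => 0).
  have [F hF] := bernstein W hchar gen_ops q (hS i (ltnW il)) (hv i il).2.
  by exists F.
case/choice_fun: hF => F hF; exists (fun p : 'I_l * 'I_(q ^ n) => F p.1 p.2); split; last first.
  by move=> [i j]; apply: (hF i (ltn_ord i)).2.
have h := @indep_layers _ _ S _ F l (fun i il => (hS i il).1) mono
  (fun i il => (hF i il).1).
move=> c hc; apply: h => [i j il|].
  apply: (Gam_Dstable (hS i.+1 il) _ ((hF i il).2 j)) => y.
  by rewrite inE => /eqP ->; apply: (hv i il).1.
by rewrite -hc; case: (hS 0%N (leq0n _)) => -[].
Qed.

Lemma chain_bound G : (forall x, exists d, Gam ops G d x) ->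
  ~ (forall q, (0 < q)%N -> exists (I : finType) (F : I -> M),
    [/\ #|I| = (q ^ n.+1)%N, indep (eq 0) F & forall i, Gam ops G (n.+1 * q) (F i)]) ->
  exists B, forall l S, (forall i, (i <= l)%N -> Dstable mulA D (S i)) ->
    (forall i x, (i < l)%N -> S i x -> S i.+1 x) ->
    (forall i, (i < l)%N -> exists x, S i.+1 x /\ ~ S i x) -> (l <= B)%N.
Proof.
move=> hG /(Gam_poly_bound W gen_ops ops_gen) [K hK].
exists (K * (4 * n).+1 ^ n)%N => l S hS mono hv.
have hv' i : exists x, (i < l)%N -> S i.+1 x /\ ~ S i x.
  have [il|il] := ltnP i l; last by exists 0.
  by have [x hx] := hv i il; exists x.
have [v {}hv] := choice_fun hv'.
have [d hd] := choice_fun (fun i => hG (v i)).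
(* All v i lie in filtration degree s. With q = s+1 the bound K (4nq+s+1)^n equals K (4n+1)^n q^n,
   and q^n cancels against l q^n. *)
pose s := (\max_(i < l) d i)%N; pose q := s.+1.
have [F [iF GF]] := chain_growth q hS mono hv.
have [J [H [cJ hH]]] := hK (4 * n * q + s)%N.
have : (#|{: 'I_l * 'I_(q ^ n)}| <= #|J|)%N.
  apply: (indep_leq_card (@subspace_zero _ _) iF) => p; apply: hH.
  apply: Gam_nest (GF p); apply: (Gam_leq _ (hd p.1)).
  exact: (leq_bigmax (F := fun i : 'I_l => d i)).
rewrite card_prod !card_ord => /leq_trans /(_ cJ) le.
have e : ((4 * n * q + s).+1 = (4 * n).+1 * q)%N by rewrite /q; lia.
by move: le; rewrite e expnMn mulnA leq_pmul2r // expn_gt0.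
Qed.

End DGenerated.

(** * Holonomic modules are finitely generated over the Weyl algebra *)

Section AVHolonomic.
Variables (k : fieldType) (n : nat) (M : lmodType k).
Variables (mulA : {mpoly k[n]} -> M -> M).
Variables (actV : ({mpoly k[n]} -> {mpoly k[n]}) -> M -> M).
Hypothesis hAV : is_AVmodule mulA actV.
Hypothesis hchar : [pchar k] =i pred0.
Hypothesis hGK : GKdim_AV mulA actV = Rbar.Finite (INR n).
Notation A := {mpoly k[n]}.
Let D i := actV (pder (k := k) i).
Let W : weyl_module mulA D := AV_weyl hAV.

Let fs : seq A := [seq 'X_i | i <- enum 'I_n].
Let dops := [seq mulA f | f <- fs] ++ [seq actV d | d <- [seq pder i | i <- enum 'I_n]].
Let vs : seq (A -> A) := [seq xder (bmnm p.1) p.2 | p <- enum {: 'X_{1..n < 4} * 'I_n}].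
Let vops := [seq mulA f | f <- fs] ++ [seq actV d | d <- vs].

Let gen_dops i : List.In (gen mulA D i) dops.
Proof.
apply/In_cat; elim/split_ind: i => j; first rewrite gen_l; last rewrite gen_r.
  by left; apply/In_map/mem_In/map_f; rewrite mem_enum.
by right; apply: In_map; apply/In_map/mem_In; rewrite mem_enum.
Qed.

Let dops_gen op : List.In op dops -> exists i, op = gen mulA D i.
Proof.
move/In_cat => [h|h]; have [d hd ->] := In_map_inv h; have [i _ ->] := In_map_inv hd.
  by exists (lshift n i); rewrite gen_l.
by exists (rshift n i); rewrite gen_r.
Qed.

Let xder_in a i : (mdeg a <= 3)%N -> List.In (actV (xder a i)) vops.
Proof.
move=> ha; apply/In_cat; right; have h : (mdeg a < 4)%N by [].
apply: In_map.
apply: (In_map (fun p : 'X_{1..n < 4} * 'I_n => xder (bmnm p.1) p.2)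
  (x := (BMultinom h, i))).
by apply: mem_In; rewrite mem_enum.
Qed.

Let dops_vops op : List.In op dops -> List.In op vops.
Proof.
move/In_cat => [h|h]; first by apply/In_cat; left.
by have [d hd ->] := In_map_inv h; have [i _ ->] := In_map_inv hd; apply: xder_in; rewrite mdeg0.
Qed.

Lemma vs_der d : List.In d vs -> is_der d.
Proof. by move=> h; have [p _ ->] := In_map_inv h; apply: is_der_xder. Qed.

Lemma pder_der d : List.In d [seq pder (k := k) i | i <- enum 'I_n] -> is_der d.
Proof. by move=> h; have [p _ ->] := In_map_inv h; apply: is_der_xder. Qed.

Lemma AVsub_Dstable S : is_AVsub mulA actV S -> Dstable mulA D S.
Proof.
move=> [h0 [h1 [h2 h3]]]; split=> // i x sx; elim/split_ind: i => j.
  by rewrite gen_l; apply: h2.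
by rewrite gen_r; apply: h3 => //; apply: is_der_xder.
Qed.

Section Ascending.
Variable M0 : seq M.

Let N i := Dspan mulA D (fun y => y \in words vops M0 i).

Let N_mono i x : N i x -> N i.+1 x.
Proof. by apply: Dspan_trans => y hy; apply: Dspan_incl; apply: mem_wordsS. Qed.

(* If C is spanned by 1 and the derivations of degree at most 3, then
   C D_n is contained in D_n C, as C is stable under bracketing with d_p. *)
Let N_xder i a l x : (mdeg a <= 3)%N -> N i x -> N i.+1 (actV (xder a l) x).
Proof.
move=> ha hx.
pose S x := N i.+1 x /\ forall a l, (mdeg a <= 3)%N -> N i.+1 (actV (xder a l) x).
have [sN gN] : Dstable mulA D (N i.+1) by apply: Dspan_stable.
have hS : Dstable mulA D S.
  have hl b j := actV_lin hAV (is_der_xder k b j).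
  split; first split.
  - by split=> [|b j _]; rewrite ?(lin0 (hl b j)); case: sN.
  - move=> c y z [y1 y2] [z1 z2]; split=> [|b j hb]; rewrite ?hl; apply: sN.2 => //.
      exact: y2.
    exact: z2.
  move=> p y [y1 y2]; split=> [|b j hb]; first exact: gN.
  have hy := y2 b j hb; have hp := gN p _ hy.
  elim/split_ind: p hp => p.
    rewrite gen_l => hp; rewrite (actV_leibniz hAV _ _ (is_der_xder k b j)).
    by apply: (subspaceD sN) => //; apply: (Dstable_mulA W _ (conj sN gN)).
  rewrite gen_r => hp.
  have e := actV_pder_bracket hAV b p j y.
  have -> : actV (xder b j) (D p y) =
    D p (actV (xder b j) y) - (b p)%:R *: actV (xder (b - U_(p))%MM j) y.
    by rewrite -e opprB addrC subrK.
  apply: (subspaceB sN) => //; apply: (subspaceZ _ sN); apply: y2.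
  exact: leq_trans (mdegB _ _) hb.
have [_ h] : S x; last exact: h.
apply: (hx S) => // y hy; split; first by apply: Dspan_incl; apply: mem_wordsS.
move=> b j hb; apply: Dspan_incl; apply: mem_words_op => //; exact: xder_in.
Qed.

Lemma words_dops_vops w d e y : w \in words vops M0 e ->
  y \in words dops [:: w] d -> y \in words vops M0 (d + e).
Proof.
move=> hw; elim: d y => [|d IH] y; first by rewrite /= inE => /eqP ->.
case/mem_wordsS_inv => [/IH|[op [z [/dops_vops h /IH hz ->]]]].
  exact: mem_wordsS.
exact: mem_words_op.
Qed.

Lemma ascending_stops : exists i, forall y, y \in words vops M0 i.+1 -> N i y.
Proof.
apply: NNPP => hno.
have hex i : exists w, w \in words vops M0 i.+1 /\ ~ N i w.
  apply: NNPP => nw; apply: hno; exists i => y hy.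
  by apply: NNPP => ny; apply: nw; exists y.
have [w hw] := choice_fun hex.
(* The first q layers give q q^n vectors: Bernstein words of length 4nq are applied to some w_i,
   itself a word of length at most q. *)
apply: (@GKdim_no_growth _ _ _ mulA actV fs vs M0 (4 * n).+1 hGK vs_der) => // q q0.
have [|F [iF GF]] := @chain_growth _ _ _ _ _ W _ gen_dops dops_gen hchar N w q q
    (fun i _ => Dspan_stable _ _ _) (fun i x _ => @N_mono i x).
  by move=> i _; split; [apply: Dspan_incl; apply: (hw i).1 | apply: (hw i).2].
exists ('I_q * 'I_(q ^ n))%type, F; split=> //.
  by rewrite card_prod !card_ord expnS.
move=> p; apply: lspan_trans (GF p) => y hy; apply: lspan_incl.
apply: (@mem_words_leq _ _ _ _ (4 * n * q + p.1.+1)); first by have := ltn_ord p.1; lia.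
exact: words_dops_vops (hw p.1).1 hy.
Qed.

(** Fields of degree at most 3 map N i into N i.+1, which is now contained in N i; [AVsub_crit] does
    the rest. *)
Lemma Dspan_AVsub i : (forall y, y \in words vops M0 i.+1 -> N i y) ->
  is_AVsub mulA actV (N i).
Proof.
move=> hi; have hN x : N i.+1 x -> N i x by apply: Dspan_trans.
have [sN gN] : Dstable mulA D (N i) by apply: Dspan_stable.
apply: AVsub_crit => // [j x sx|a j x ha sx].
  by have := gN (lshift n j) x sx; rewrite gen_l.
by apply: hN; apply: N_xder.
Qed.

End Ascending.

Lemma AV_chain_bound : AV_fin_gen mulA actV ->
  exists B, forall l S, (forall i, (i <= l)%N -> is_AVsub mulA actV (S i)) ->
    (forall i x, (i < l)%N -> S i x -> S i.+1 x) ->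
    (forall i, (i < l)%N -> exists x, S i.+1 x /\ ~ S i x) -> (l <= B)%N.
Proof.
move=> [M0 hM0]; have [i hi] := ascending_stops M0.
have hN : forall x, Dspan mulA D (fun y => y \in words vops M0 i) x.
  apply: hM0; first exact: Dspan_AVsub.
  by move=> g hg; apply: Dspan_incl; apply: (mem_words_leq (leq0n i)).
have [B hB] : exists B, forall l S, (forall i, (i <= l)%N -> Dstable mulA D (S i)) ->
    (forall i x, (i < l)%N -> S i x -> S i.+1 x) ->
    (forall i, (i < l)%N -> exists x, S i.+1 x /\ ~ S i x) -> (l <= B)%N.
  apply: (chain_bound W gen_dops dops_gen hchar (G := words vops M0 i)).
    by move=> x; apply: (Dspan_Gam W gen_dops (hN x)).
  exact: (GKdim_no_growth hGK pder_der).
by exists B => l S hS; apply: hB => j jl; apply: AVsub_Dstable; apply: hS.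
Qed.

End AVHolonomic.

Lemma bounded_max (P : nat -> Prop) l0 B : P l0 -> (forall l, P l -> (l <= B)%N) ->
  exists l, P l /\ forall l', P l' -> (l' <= l)%N.
Proof.
move=> hP hB; apply: NNPP => hno.
suff h i : exists l, P l /\ (i <= l)%N.
  by have [l [/hB lB]] := h B.+1; rewrite ltnNge lB.
elim: i => [|i [l [Pl il]]]; first by exists l0.
apply: NNPP => hi; apply: hno; exists l; split=> // l' Pl'.
rewrite leqNgt; apply/negP => ll'; apply: hi; exists l'; split=> //.
exact: leq_ltn_trans il ll'.
Qed.

(** * From bounded chains to composition series *)

Section FiniteLength.
Variables (k : fieldType) (n : nat) (M : lmodType k).
Variables (mulA : {mpoly k[n]} -> M -> M).
Variables (actV : ({mpoly k[n]} -> {mpoly k[n]}) -> M -> M).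
Hypothesis hAV : is_AVmodule mulA actV.

Definition AV_chain l (S : nat -> M -> Prop) :=
  [/\ forall i, (i <= l)%N -> is_AVsub mulA actV (S i),
      forall x, S 0%N x <-> x = 0, forall x, S l x,
      forall i x, (i < l)%N -> S i x -> S i.+1 x &
      forall i, (i < l)%N -> exists x, S i.+1 x /\ ~ S i x].

Lemma AVsub_zero : is_AVsub mulA actV (fun x => x = 0).
Proof.
split=> //; split=> [c x y -> ->|]; first by rewrite scaler0 addr0.
split=> [f x ->|d x hd ->]; first exact: (lin0 (wmul_lin (AV_weyl hAV) f)).
exact: (lin0 (actV_lin hAV hd)).
Qed.

Lemma AV_chain_exists : exists l S, AV_chain l S.
Proof.
have [h|h] := classic (forall x : M, x = 0).
  exists 0%N, (fun _ x => x = 0); split=> //= i _; exact: AVsub_zero.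
exists 1%N, (fun i x => if i is 0%N then x = 0 else True); split=> //.
- by move=> [_|i _]; [exact: AVsub_zero|].
- move=> [|i] // _; apply: NNPP => nx; apply: h => x; apply: NNPP => x0.
  by apply: nx; exists x.
Qed.

Lemma AV_chain_refine l S i T : AV_chain l S -> (i < l)%N -> is_AVsub mulA actV T ->
  (forall x, S i x -> T x) -> (forall x, T x -> S i.+1 x) ->
  ~ (forall x, T x -> S i x) -> ~ (forall x, S i.+1 x -> T x) ->
  exists S', AV_chain l.+1 S'.
Proof.
move=> [h1 h2 h3 h4 h5] il hT ST TS nTS nST.
(* T takes position i+1 and all later terms move up by one. *)
exists (fun j => if (j <= i)%N then S j else if j == i.+1 then T else S j.-1); split.
- move=> j jl; case: leqP => ji; first by apply: h1; lia.
  by case: eqP => // _; apply: h1; lia.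
- by rewrite leq0n.
- have -> : (l.+1 <= i)%N = false by lia.
  by have -> : (l.+1 == i.+1) = false by lia.
- move=> j x jl; have [ji|ij|->] := ltngtP j i; last by rewrite eqxx; apply: ST.
    by apply: h4; lia.
  rewrite eqSS (gtn_eqF ij); have [->|nj] := eqVneq j i.+1; first exact: TS.
  by case: j jl ij nj => // j jl ij nj; apply: h4; lia.
move=> j jl; have [ji|ij|->] := ltngtP j i.
- by apply: h5; lia.
- rewrite eqSS (gtn_eqF ij); have [->|nj] := eqVneq j i.+1.
    apply: NNPP => nx; apply: nST => x sx; apply: NNPP => tx; apply: nx.
    by exists x.
  by case: j jl ij nj => // j jl ij nj; apply: h5; lia.
rewrite eqxx; apply: NNPP => nx; apply: nTS => x tx; apply: NNPP => sx; apply: nx.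
by exists x.
Qed.

(** A strict chain of maximal length admits no refinement, so its factors are simple. *)
Lemma finite_length_of_bound B :
  (forall l S, AV_chain l S -> (l <= B)%N) -> AV_finite_length mulA actV.
Proof.
move=> hB; have [l0 h0] := AV_chain_exists.
have hB' l : (exists S, AV_chain l S) -> (l <= B)%N by case=> S; apply: hB.
have [l [[S hS] hmax]] := bounded_max h0 hB'.
exists l, S; have [h1 h2 h3 h4 h5] := hS; split=> //; split=> //; split=> // i il.
split; first by move=> x; apply: h4.
split; first exact: h5.
move=> T hT ST TS; apply: NNPP => hno.
have := hmax l.+1; rewrite ltnn => h; suff: False by [].
suff /h : exists S', AV_chain l.+1 S' by [].
apply: (AV_chain_refine hS il hT ST TS) => hx; apply: hno; [by left | by right].
Qed.

End FiniteLength.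

Theorem theorem3p9 (k : closedFieldType)
  (hchar : [pchar k]%R =i pred0)
  (huncount : ~ (exists e : nat -> k, forall x : k, exists i, e i = x))
  (n : nat) (M : lmodType k)
  (mulA : {mpoly k[n]} -> M -> M) (actV : ({mpoly k[n]} -> {mpoly k[n]}) -> M -> M)
  (hAV : is_AVmodule mulA actV)
  (hhol : AV_holonomic mulA actV) :
  AV_finite_length mulA actV.
Proof.
have [hfg [h0|hGK]] := hhol.
  (* In the zero module no inclusion is strict, so chains have length 0. *)
  apply: (finite_length_of_bound hAV (B := 0)) => l S [_ h2 _ _ h5].
  rewrite leqNgt; apply/negP => /h5 [x [_]]; apply.
  by apply/h2; rewrite (h0 x).
have [B hB] := AV_chain_bound hAV hchar hGK hfg.
by apply: (finite_length_of_bound hAV (B := B)) => l S [h1 _ _ h4 h5]; apply: hB h1 h4 h5.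
Qed.
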